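(* Let $A \in \mathbb{C}^{m \times n}$ be a matrix of rank $k$ to which we have sampling access in the following sense: (i) we can sample a row index $i \in \{1,\ldots,m\}$ with probability $\|A(i,\cdot)\|^2/\|A\|_F^2$; (ii) for every $i \in \{1,\ldots,m\}$ we can sample a column index $j \in \{1,\ldots,n\}$ with probability $|A(i,j)|^2/\|A(i,\cdot)\|^2$. Let $b \in \mathbb{C}^m$ be a vector to which we have sampling access in the sense that we can sample an index $i \in \{1,\ldots,m\}$ with probability $|b(i)|^2/\|b\|^2$. Let $\kappa$ be the condition number of $A$. Then there exists an algorithm that, given an index $i \in \{1,\ldots,n\}$, $\epsilon>0$ and $\delta\in(0,1)$, outputs an approximation of $(A^{-1}b)(i)$ with additive error $\epsilon$ with success probability at least $1-\delta$, using $$O\left(\mathrm{poly}\left(k,\kappa,\|A\|_F,\tfrac{1}{\epsilon}\right)\mathrm{polylog}(m,n)\log\left(\tfrac{1}{\delta}\right)\right)$$ queries and time.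
   Context: $\|\cdot\|$ denotes the Euclidean / spectral norm and $\|\cdot\|_F$ the Frobenius norm; $A(i,\cdot)$ is the $i$-th row and $A(i,j)$ the $(i,j)$ entry of $A$. Entries of $A$ and $b$, row norms of $A$, $\|A\|_F$ and $\|b\|$ can be queried (as provided by standard binary-tree data structures storing $A$ and $b$). $A^{-1}$ denotes the Moore–Penrose pseudo-inverse: if $A=\sum_{i=1}^k \sigma_i u_i v_i^\dagger$ is a singular value decomposition, $A^{-1}=\sum_{i=1}^k \sigma_i^{-1} v_i u_i^\dagger$. The condition number is $\kappa=\|A\|/\sigma_{\min}(A)$ where $\sigma_{\min}(A)$ is the smallest nonzero singular value of $A$.
   Formalization: The bound carries an extra factor polynomial in 1+‖b‖/‖A‖ (constant for normalized A, b), since the stated bound fails when b is scaled up or A down; A is nonzero, k and κ are given to the algorithm, and time is unit-cost exact arithmetic. *)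

(* Defs.v *)
From HB Require Import structures.
From mathcomp Require Import all_boot all_order all_algebra.
From mathcomp Require Import spectral.
From mathcomp Require Import all_classical all_reals all_analysis.
From mathcomp Require Import complex.

Set Implicit Arguments.
Unset Strict Implicit.
Unset Printing Implicit Defensive.

Import Order.TTheory GRing.Theory Num.Theory.
Import Normc.
Local Open Scope ring_scope.
Local Open Scope complex_scope.
Local Open Scope sesquilinear_scope.
Local Open Scope classical_set_scope.

Section LinearAlgebra.
Variable R : realType.
Local Notation C := R[i].

(* On row and column vectors this is the Euclidean norm. *)
Definition frobenius_norm m n (A : 'M[C]_(m, n)) : R :=
  Num.sqrt (\sum_(i < m) \sum_(j < n) normc (A i j) ^+ 2).

Definition spectral_norm m n (A : 'M[C]_(m, n)) : R :=
  sup [set frobenius_norm (A *m x) | x in [set x : 'cV[C]_n | frobenius_norm x <= 1]].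

(* Compact form: only the nonzero singular values are listed, and the singular
   vectors are the columns of U and V. *)
Definition is_svd m n k (A : 'M[C]_(m, n))
    (sigma : 'I_k -> R) (U : 'M[C]_(m, k)) (V : 'M[C]_(n, k)) : Prop :=
  [/\ U^t* *m U = 1%:M, V^t* *m V = 1%:M, (forall i, 0 < sigma i)
    & A = \sum_(i < k) (sigma i)%:C *: (col i U *m (col i V)^t*)].

Definition svd_pinv m n k
    (sigma : 'I_k -> R) (U : 'M[C]_(m, k)) (V : 'M[C]_(n, k)) : 'M[C]_(n, m) :=
  \sum_(i < k) (sigma i)^-1%:C *: (col i V *m (col i U)^t*).

(* The Moore-Penrose pseudo-inverse, read off from a chosen SVD; [pseudo_inverseE]
   below shows that every SVD gives the same matrix, and [svd_exists] that one exists. *)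
Definition pseudo_inverse m n (A : 'M[C]_(m, n)) : 'M[C]_(n, m) :=
  xget 0 [set X | exists k (sigma : 'I_k -> R) (U : 'M[C]_(m, k))
                    (V : 'M[C]_(n, k)),
                    is_svd A sigma U V /\ X = svd_pinv sigma U V].

Definition nonzero_singular_value m n (A : 'M[C]_(m, n)) : set R :=
  [set s | exists k (sigma : 'I_k -> R) (U : 'M[C]_(m, k)) (V : 'M[C]_(n, k)),
             is_svd A sigma U V /\ exists i, s = sigma i].

(* Meaningful for A != 0 only. *)
Definition sigma_min m n (A : 'M[C]_(m, n)) : R :=
  inf (nonzero_singular_value A).

Definition condition_number m n (A : 'M[C]_(m, n)) : R :=
  spectral_norm A / sigma_min A.

End LinearAlgebra.

(* Matrix form of the two sums, for the facts that validate [pseudo_inverse]. *)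
Section PinvFacts.
Variable R : realType.
Local Notation C := R[i].

Lemma sum_outer m n k (c : 'I_k -> C) (U : 'M[C]_(m, k)) (V : 'M[C]_(n, k)) :
  \sum_(i < k) c i *: (col i U *m (col i V)^t*) =
  U *m diag_mx (\row_i c i) *m V^t*.
Proof.
apply/matrixP => a b; rewrite summxE mxE; apply: eq_bigr => i _.
rewrite !mxE big_ord1 !mxE (bigD1 i) //= big1 ?addr0.
  by rewrite !mxE eqxx mulr1n mulrCA mulrA.
by move=> j ji; rewrite !mxE (negPf ji) mulr0n mulr0.
Qed.

Lemma svd_exists m n (A : 'M[C]_(m, n)) :
  exists k (sigma : 'I_k -> R) (U : 'M[C]_(m, k)) (V : 'M[C]_(n, k)),
    is_svd A sigma U V.
Proof.
pose H := A^t* *m A.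
have Hherm : H \is hermsymmx.
  by apply/is_hermitianmxP; rewrite expr0 scale1r /H trmx_mul map_mxM trmxCK.
pose V0 := (spectralmx H)^t*; pose d := spectral_diag H.
have V0V : V0 *m V0^t* = 1%:M.
  rewrite /V0 trmxCK -invmx_unitary ?spectral_unitarymx //.
  by rewrite mulVmx // spectral_unit.
have VV0 : V0^t* *m V0 = 1%:M.
  by rewrite /V0 trmxCK; apply/unitarymxP/spectral_unitarymx.
have HE : H = V0 *m diag_mx d *m V0^t*.
  have /orthomx_spectralP HE := hermitian_normalmx Hherm.
  by rewrite {1}HE invmx_unitary ?spectral_unitarymx // /V0 trmxCK.
pose W := A *m V0.
have WW : W^t* *m W = diag_mx d.
  rewrite /W trmx_mul map_mxM -mulmxA [A^t* *m _]mulmxA -/H HE.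
  by rewrite -!mulmxA VV0 mulmx1 mulmxA VV0 mul1mx.
have dE j : d 0 j = \sum_a `|W a j| ^+ 2.
  have /matrixP/(_ j j) := WW; rewrite !mxE eqxx mulr1n => <-.
  by apply: eq_bigr => a _; rewrite !mxE normCK mulrC.
have d0 j : 0 <= d 0 j by rewrite dE sumr_ge0 // => a _; rewrite exprn_ge0.
have W0 j : d 0 j = 0 -> col j W = 0.
  rewrite dE => /eqP; rewrite psumr_eq0 => [/allP W0|a _]; last exact: exprn_ge0.
  apply/colP => a; rewrite !mxE; apply/eqP.
  by have := W0 a (mem_index_enum _); rewrite expf_eq0 normr_eq0 /= mxE.
pose J := [pred j | d 0 j != 0]; pose e (i : 'I_#|J|) : 'I_n := enum_val i.
pose s (i : 'I_#|J|) : R := Num.sqrt (complex.Re (d 0 (e i))).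
have dRe j : (complex.Re (d 0 j))%:C = d 0 j by rewrite RRe_real // ger0_real.
have s0 i : 0 < s i.
  have := enum_valP i; rewrite -/(e i) inE /s sqrtr_gt0 => de.
  by rewrite -ltcR dRe lt0r de d0.
have s2 i : (s i)%:C * (s i)%:C = d 0 (e i).
  by rewrite -rmorphM /= -expr2 sqr_sqrtr ?dRe // -ler0c dRe.
have sC i : (s i)%:C != 0 :> C by rewrite gt_eqF // ltcR.
exists #|J|, s, (\matrix_(a, i) ((s i)%:C^-1 * W a (e i))),
  (\matrix_(a, i) V0 a (e i)).
split=> //.
- apply/matrixP => i j; rewrite !mxE.
  have /matrixP/(_ (e i) (e j)) := WW; rewrite !mxE => WWij.
  transitivity ((s i)%:C^-1 * (s j)%:C^-1 * (d 0 (e i) *+ (e i == e j))).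
    rewrite -WWij mulr_sumr; apply: eq_bigr => a _; rewrite !mxE rmorphM fmorphV /=.
    have -> : Num.conj (s i)%:C = (s i)%:C :> C.
      by rewrite conj_Creal // ger0_real // ler0c ltW.
    by rewrite mulrACA.
  rewrite (inj_eq enum_val_inj); case: eqP => [<-|]; last by rewrite mulr0.
  by rewrite mulr1n -s2 mulrACA !mulVf // mulr1.
- apply/matrixP => i j; rewrite !mxE.
  have /matrixP/(_ (e i) (e j)) := VV0; rewrite !mxE (inj_eq enum_val_inj) => <-.
  by apply: eq_bigr => a _; rewrite !mxE.
rewrite -[LHS]mulmx1 -V0V mulmxA -/W.
have -> : W *m V0^t* = \sum_j col j W *m (col j V0)^t*.
  apply/matrixP => a b; rewrite summxE mxE; apply: eq_bigr => j _.
  by rewrite !mxE big_ord1 !mxE.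
rewrite (bigID (mem J)) /= [X in _ + X]big1 ?addr0; last first.
  by move=> j; rewrite inE negbK => /eqP/W0 ->; rewrite mul0mx.
rewrite big_enum_val; apply: eq_bigr => i _.
apply/matrixP => a b; rewrite !mxE !big_ord1 !mxE -/(e i).
by rewrite !mulrA divff // mul1r.
Qed.

Lemma svd_pinvE m n k k' (A : 'M[C]_(m, n))
    (s : 'I_k -> R) (U : 'M[C]_(m, k)) (V : 'M[C]_(n, k))
    (s' : 'I_k' -> R) (U' : 'M[C]_(m, k')) (V' : 'M[C]_(n, k')) :
  is_svd A s U V -> is_svd A s' U' V' -> svd_pinv s U V = svd_pinv s' U' V'.
Proof.
move=> [UU VV s0 AE] [UU' VV' s0' AE'].
have P p (t : 'I_p -> R) (W : 'M[C]_(m, p)) (Z : 'M[C]_(n, p)) :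
    is_svd A t W Z -> exists X, [/\ X = svd_pinv t W Z, A *m X *m A = A,
      X *m A *m X = X, (A *m X)^t* = A *m X & (X *m A)^t* = X *m A].
  move=> [WW ZZ t0 ->]; exists (svd_pinv t W Z).
  rewrite /svd_pinv !sum_outer.
  set E := diag_mx _; set D := diag_mx _.
  have DE : D *m E = 1%:M.
    rewrite mulmx_diag -diag_const_mx; congr diag_mx; apply/rowP => i.
    by rewrite !mxE -rmorphM /= divff ?rmorph1 // gt_eqF.
  have ED : E *m D = 1%:M by rewrite diag_mxC.
  have AX : W *m D *m Z^t* *m (Z *m E *m W^t*) = W *m W^t*.
    by rewrite !mulmxA -(mulmxA _ _ Z) ZZ mulmx1 -(mulmxA W) DE mulmx1.
  have XA : Z *m E *m W^t* *m (W *m D *m Z^t*) = Z *m Z^t*.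
    by rewrite !mulmxA -(mulmxA _ _ W) WW mulmx1 -(mulmxA Z) ED mulmx1.
  rewrite AX XA; split=> //.
  - by rewrite !mulmxA -(mulmxA _ _ W) WW mulmx1.
  - by rewrite !mulmxA -(mulmxA _ _ Z) ZZ mulmx1.
  - by rewrite trmx_mul map_mxM trmxCK.
  - by rewrite trmx_mul map_mxM trmxCK.
have [X [<- X1 X2 X3 X4]] := P _ _ _ _ (And4 UU VV s0 AE).
have [Y [<- Y1 Y2 Y3 Y4]] := P _ _ _ _ (And4 UU' VV' s0' AE').
have AXY : A *m X = A *m Y.
  rewrite -X3 -{1}Y1 -(mulmxA _ A X) trmx_mul map_mxM X3 Y3 mulmxA.
  by rewrite X1.
have XYA : X *m A = Y *m A.
  rewrite -X4 -{1}Y1 -mulmxA mulmxA trmx_mul map_mxM X4 Y4 -mulmxA [A *m _]mulmxA.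
  by rewrite X1.
by rewrite -X2 -mulmxA AXY mulmxA XYA.
Qed.

Lemma pseudo_inverseE m n k (A : 'M[C]_(m, n))
    (sigma : 'I_k -> R) (U : 'M[C]_(m, k)) (V : 'M[C]_(n, k)) :
  is_svd A sigma U V -> pseudo_inverse A = svd_pinv sigma U V.
Proof.
move=> AUV; rewrite /pseudo_inverse.
case: xgetP => [X -> [k' [s' [U' [V' [AUV' ->]]]]]|].
  exact: svd_pinvE AUV' AUV.
by move=> /(_ (svd_pinv sigma U V))[]; exists k, sigma, U, V.
Qed.

End PinvFacts.

(* Computation model: a unit-cost real RAM (with complex-valued cells, exact
   arithmetic, no rounding) extended with oracle instructions for A and b.
   A machine has two unbounded memories, both addressed by natural numbers:
   an index memory holding naturals and a value memory holding complex numbers.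
   Operands d, p, q, s of instructions are addresses; the indirect instructions
   dereference through the index memory. A program is a finite syntactic object
   whose only literals are natural numbers, so it cannot depend on the input. *)
Inductive arith := Add | Sub | Mul | Div.

Inductive instr :=
  | IConst of nat & nat              (* imem[d] := literal               *)
  | IAdd of nat & nat & nat          (* imem[d] := imem[p] + imem[q]       *)
  | ISub of nat & nat & nat          (* imem[d] := imem[p] - imem[q], truncated *)
  | ILoad of nat & nat               (* imem[d] := imem[imem[p]]           *)
  | IStore of nat & nat              (* imem[imem[p]] := imem[s]           *)
  | IRandom of nat & nat             (* imem[d] := uniform in [0, imem[p]) *)
  | VOfIndex of nat & nat            (* vmem[d] := imem[p]                *)
  | VArith of arith & nat & nat & nat (* vmem[d] := vmem[p] op vmem[q]     *)
  | VConj of nat & nat               (* vmem[d] := conjugate of vmem[p]   *)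
  | VLoad of nat & nat               (* vmem[d] := vmem[imem[p]]           *)
  | VStore of nat & nat              (* vmem[imem[p]] := vmem[s]           *)
  | QueryA of nat & nat & nat        (* vmem[d] := A(imem[p], imem[q])     *)
  | QueryRowNorm of nat & nat        (* vmem[d] := ||A(imem[p], .)||      *)
  | QueryFrobenius of nat            (* vmem[d] := ||A||_F               *)
  | QueryB of nat & nat              (* vmem[d] := b(imem[p])             *)
  | QueryNormB of nat                (* vmem[d] := ||b||                 *)
  | SampleRow of nat                 (* imem[d] := i w.p. ||A(i, .)||^2 / ||A||_F^2 *)
  | SampleCol of nat & nat           (* imem[d] := j w.p. |A(i, j)|^2 / ||A(i, .)||^2, i = imem[p] *)
  | SampleB of nat.                  (* imem[d] := i w.p. |b(i)|^2 / ||b||^2 *)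

Inductive test :=
  | TIndexLt of nat & nat            (* imem[p] < imem[q]                 *)
  | TValueLt of nat & nat.           (* Re vmem[p] < Re vmem[q]           *)

Inductive program :=
  | Instr of instr
  | Seq of program & program
  | If of test & program & program
  | While of test & program.

Definition is_query (a : instr) : bool :=
  match a with
  | QueryA _ _ _ | QueryRowNorm _ _ | QueryFrobenius _ | QueryB _ _
  | QueryNormB _ | SampleRow _ | SampleCol _ _ | SampleB _ => true
  | _ => false
  end.

Section Machine.
Variable R : realType.
Local Notation C := R[i].

Record memory := Memory { imem : nat -> nat; vmem : nat -> C }.

Definition set_idx (s : memory) (d v : nat) : memory :=
  Memory [eta imem s with d |-> v] (vmem s).

Definition set_val (s : memory) (d : nat) (v : C) : memory :=
  Memory (imem s) [eta vmem s with d |-> v].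

Definition eval_arith (o : arith) (x y : C) : C :=
  match o with Add => x + y | Sub => x - y | Mul => x * y | Div => x / y end.

Definition eval_test (t : test) (s : memory) : bool :=
  match t with
  | TIndexLt p q => (imem s p < imem s q)%N
  | TValueLt p q => complex.Re (vmem s p) < complex.Re (vmem s q)
  end.

Variables (m n : nat) (A : 'M[C]_(m, n)) (b : 'cV[C]_m).

(* The possible outcomes of one instruction with their probabilities. An
   instruction that is not defined (an index out of range, a sample from a zero
   row or a zero vector, where the weights below are x / 0 = 0) has no outcome of
   positive probability; the probability mass of that execution is lost, so it
   can never count as a success. *)
Definition exec (a : instr) (s : memory) : seq (R * memory) :=
  match a with
  | IConst d v => [:: (1, set_idx s d v)]
  | IAdd d p q => [:: (1, set_idx s d (imem s p + imem s q)%N)]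
  | ISub d p q => [:: (1, set_idx s d (imem s p - imem s q)%N)]
  | ILoad d p => [:: (1, set_idx s d (imem s (imem s p)))]
  | IStore p r => [:: (1, set_idx s (imem s p) (imem s r))]
  | IRandom d p =>
      [seq ((imem s p)%:R^-1, set_idx s d v) | v <- iota 0 (imem s p)]
  | VOfIndex d p => [:: (1, set_val s d (imem s p)%:R)]
  | VArith o d p q => [:: (1, set_val s d (eval_arith o (vmem s p) (vmem s q)))]
  | VConj d p => [:: (1, set_val s d (vmem s p)^*)]
  | VLoad d p => [:: (1, set_val s d (vmem s (imem s p)))]
  | VStore p r => [:: (1, set_val s (imem s p) (vmem s r))]
  | QueryA d p q =>
      match insub (imem s p) : option 'I_m, insub (imem s q) : option 'I_n with
      | Some i, Some j => [:: (1, set_val s d (A i j))]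
      | _, _ => [::]
      end
  | QueryRowNorm d p =>
      if insub (imem s p) is Some i
      then [:: (1, set_val s d (frobenius_norm (row i A))%:C)] else [::]
  | QueryFrobenius d => [:: (1, set_val s d (frobenius_norm A)%:C)]
  | QueryB d p =>
      if insub (imem s p) is Some i
      then [:: (1, set_val s d (b i 0))] else [::]
  | QueryNormB d => [:: (1, set_val s d (frobenius_norm b)%:C)]
  | SampleRow d =>
      [seq (frobenius_norm (row i A) ^+ 2 / frobenius_norm A ^+ 2, set_idx s d i)
         | i <- enum 'I_m]
  | SampleCol d p =>
      if insub (imem s p) is Some i
      then [seq (normc (A i j) ^+ 2 / frobenius_norm (row i A) ^+ 2, set_idx s d j)
              | j <- enum 'I_n]
      else [::]
  | SampleB d =>
      [seq (normc (b i 0) ^+ 2 / frobenius_norm b ^+ 2, set_idx s d i)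
         | i <- enum 'I_m]
  end.

(* [todo] is the stack of programs still to be executed. *)
Record config := Config { todo : seq program; mem : memory; queries : nat }.

Definition halted (c : config) : bool := nilp (todo c).

Definition step (c : config) : seq (R * config) :=
  let: Config K s q := c in
  match K with
  | [::] => [:: (1, c)]
  | Instr a :: K' =>
      [seq (w.1, Config K' w.2 (q + is_query a)%N) | w <- exec a s & w.1 != 0]
  | Seq P1 P2 :: K' => [:: (1, Config [:: P1, P2 & K'] s q)]
  | If t P1 P2 :: K' =>
      [:: (1, Config ((if eval_test t s then P1 else P2) :: K') s q)]
  | While t P1 :: K' =>
      [:: (1, Config (if eval_test t s then [:: P1, While t P1 & K'] else K') s q)]
  end.

(* The law of the configuration after T steps, as a finite list of weighted
   configurations, one for each execution of positive probability. *)
Fixpoint run (T : nat) (c : config) : seq (R * config) :=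
  if T is T'.+1 then
    [seq (w.1 * w'.1, w'.2) | w <- step c, w' <- run T' w.2]
  else [:: (1, c)].

(* Inputs. The algorithm is told the parameters k and kappa in which its cost
   is expressed; its only access to A and b is through the oracles. Row and
   column indices are numbered from 0. *)
Definition init_mem (k : nat) (i : 'I_n) (eps delta : R) : memory :=
  Memory (nth 0%N [:: m; n; k; nat_of_ord i])
         (nth 0 [:: (condition_number A)%:C; eps%:C; delta%:C]).

Definition init (P : program) (k : nat) (i : 'I_n) (eps delta : R) : config :=
  Config [:: P] (init_mem k i eps delta) 0%N.

Definition output (c : config) : C := vmem (mem c) 0%N.

(* Every execution halts within T steps and makes at most Q queries. *)
Definition uses_at_most
    (P : program) (k : nat) (i : 'I_n) (eps delta : R) (Q T : nat) : bool :=
  all (fun w => halted w.2 && (queries w.2 <= Q)%N) (run T (init P k i eps delta)).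

(* Probability of having halted within T steps with output within eps of x. *)
Definition success_probability
    (P : program) (k : nat) (i : 'I_n) (eps delta : R) (T : nat) (x : C) : R :=
  \sum_(w <- run T (init P k i eps delta)
         | halted w.2 && (normc (output w.2 - x) <= eps)) w.1.

End Machine.

(* O(poly(k, kappa, ||A||_F, 1/eps) polylog(m, n) log(1/delta)), where a bound
   polynomial in nonnegative quantities x, y, ... is written c (1 + x + y + ...)^d,
   and 1 + log is used so that the bound does not vanish at m = n = 1 or as
   delta -> 1. The last factor is the unit in which the absolute error eps is
   measured: it is a constant once A and b are normalised (||A|| = ||b|| = 1), and
   without it no algorithm exists, because multiplying b by t, or A by 1/t,
   multiplies the entries of A^-1 b by t without increasing k, kappa or ||A||_F
   (t >= 1), and so would divide the relative error by t at no cost. *)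
Definition cost_bound (R : realType) (c : R) (d : nat)
    m n (k : nat) (A : 'M[R[i]]_(m, n)) (b : 'cV[R[i]]_m) (eps delta : R) : R :=
  c * (1 + k%:R + condition_number A + frobenius_norm A + eps^-1) ^+ d
    * (1 + ln m%:R + ln n%:R) ^+ d
    * (1 + ln delta^-1)
    * (1 + frobenius_norm b / spectral_norm A) ^+ d.

(* Main.v *)
Require Import Defs.
From mathcomp Require Import all_boot all_order all_algebra.
From mathcomp Require Import spectral zify ring lra.
From mathcomp Require Import all_classical all_reals all_analysis.
From mathcomp Require Import complex.

Set Implicit Arguments.
Unset Strict Implicit.
Unset Printing Implicit Defensive.

Import Order.TTheory GRing.Theory Num.Theory.
Local Open Scope ring_scope.

(** Randomized Kaczmarz with unbiased inner products, averaged over independent runs.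

    One run keeps a combination [y] of sampled rows.  A step samples a row [a_r] by its
    norm and replaces [y] by [y + g a_r], where [g] estimates
    [conj b_r / |a_r|^2 - <y, a_r> / |a_r|^2]; the second term is the mean of [T] samples
    [y_j / A(r, j)] with [j] drawn from row [r].  The estimate is unbiased, so the mean
    error is multiplied by exactly [1 - A^* A / |A|_F^2] in each step, even if the system is
    inconsistent, and it tends to 0 because [y] stays in the row space.  As a Kaczmarz
    step is an orthogonal projection plus noise, the second moment of [y] stays below
    [4 T beta^2] after [T] steps, where [beta = |b| / |A|_F].  Entry [i] of [y] is therefore
    an estimator of polynomial variance; truncating it at a polynomial level gives
    exponential tails, and an average of polynomially many copies times [log (1 / delta)]
    is accurate with probability [1 - delta].  All loop bounds are computed from [k],
    [kappa], [eps], [delta], [|A|_F] and [|b|], since [|A|_F^2 / sigma_min^2 <= k kappa^2]. *)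

(** * Finite weighted lists as probability distributions *)

Section WeightedLists.
Variable R : realType.

(** A cost polylogarithmic in [m] and [n] forbids storing a vector of either length. An iterate
    therefore exists only as a list of row indices and coefficients, and reading one entry takes one
    query of [A] per listed row. The second moment of a run is kept bounded but not driven to 0: all
    accuracy comes from the mean, which is why every estimate must be unbiased and why independent
    runs are averaged. The number of inner-product samples per step equals the number of steps,
    because the relative noise [1 / T] of a step then compounds to [(1 + 1 / T) ^ T <= 4]. The
    machine has no logarithm, square root or rounding. Thresholds are thus rational functions of
    known quantities, reached by counting or halving, and the decay of the bias is bounded by an
    inverse of [T] instead of an exponential. Every loop is counted, so the time bound holds on all
    executions and chance affects only the output. *)

Definition expect X (mu : seq (R * X)) (g : X -> R) : R :=
  \sum_(w <- mu) w.1 * g w.2.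

Definition dbind X Y (mu : seq (R * X)) (k : X -> seq (R * Y)) : seq (R * Y) :=
  [seq (w.1 * w'.1, w'.2) | w <- mu, w' <- k w.2].

(** Outcomes of weight 0 are exempt, as [step] drops them; this is how zero rows are excluded.
    Recursion on the list replaces membership because memories, being functions, have no decidable
    equality. *)
Fixpoint almost X (P : X -> Prop) (mu : seq (R * X)) : Prop :=
  if mu is w :: mu' then (w.1 != 0 -> P w.2) /\ almost P mu' else True.

Definition nonneg_weights X (mu : seq (R * X)) : bool :=
  all (fun w => 0 <= w.1) mu.

Definition is_distr X (mu : seq (R * X)) : Prop :=
  nonneg_weights mu /\ expect mu (fun=> 1) = 1.

Lemma expect_nil X (g : X -> R) : expect [::] g = 0.
Proof. exact: big_nil. Qed.

Lemma expect_cons X w (mu : seq (R * X)) g :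
  expect (w :: mu) g = w.1 * g w.2 + expect mu g.
Proof. exact: big_cons. Qed.

Lemma expect1 X (x : X) g : expect [:: (1, x)] g = g x.
Proof. by rewrite /expect big_seq1 mul1r. Qed.

Lemma expect_bind X Y (mu : seq (R * X)) (k : X -> seq (R * Y)) g :
  expect (dbind mu k) g = expect mu (fun x => expect (k x) g).
Proof.
rewrite /expect /dbind big_allpairs_dep /=; apply: eq_bigr => w _.
by rewrite mulr_sumr; apply: eq_bigr => w' _; rewrite mulrA.
Qed.

Lemma dbind_cons X Y w (mu : seq (R * X)) (k : X -> seq (R * Y)) :
  dbind (w :: mu) k = [seq (w.1 * w'.1, w'.2) | w' <- k w.2] ++ dbind mu k.
Proof. by []. Qed.

Lemma dbind1 X Y (x : X) (k : X -> seq (R * Y)) : dbind [:: (1, x)] k = k x.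
Proof.
rewrite dbind_cons cats0 -[RHS]map_id; apply: eq_map => -[p y].
by rewrite mul1r.
Qed.

Lemma expectD X (mu : seq (R * X)) g h :
  expect mu (fun x => g x + h x) = expect mu g + expect mu h.
Proof. by rewrite /expect -big_split; apply: eq_bigr => w _; rewrite mulrDr. Qed.

Lemma expectZ X (mu : seq (R * X)) a g :
  expect mu (fun x => a * g x) = a * expect mu g.
Proof. by rewrite /expect mulr_sumr; apply: eq_bigr => w _; rewrite mulrCA. Qed.

Lemma almostT X (P : X -> Prop) (mu : seq (R * X)) :
  (forall x, P x) -> almost P mu.
Proof. by move=> PT; elim: mu. Qed.

Lemma le_expect X (mu : seq (R * X)) g h : nonneg_weights mu ->
  almost (fun x => g x <= h x) mu -> expect mu g <= expect mu h.
Proof.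
elim: mu => [|w mu IH] /=; first by rewrite !expect_nil.
move=> /andP[w0 mu0] [gh /(IH mu0) le]; rewrite !expect_cons lerD //.
by have [->|/gh] := eqVneq w.1 0; [rewrite !mul0r | exact: ler_wpM2l].
Qed.

Lemma eq_expect X (mu : seq (R * X)) g h :
  almost (fun x => g x = h x) mu -> expect mu g = expect mu h.
Proof.
elim: mu => [|w mu IH] /=; first by rewrite !expect_nil.
move=> [gh /IH le]; rewrite !expect_cons le; congr (_ + _).
by have [->|/gh ->] := eqVneq w.1 0; rewrite ?mul0r.
Qed.

(** A constant plus two functions covers all the one-step estimates below; those with a single
    function are padded with [0 * 0] to fit. *)
Lemma expect_affine X (mu : seq (R * X)) a c d g h : is_distr mu ->
  expect mu (fun x => a + c * g x + d * h x) =
  a + c * expect mu g + d * expect mu h.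
Proof.
move=> [_ mu1]; rewrite expectD expectZ expectD expectZ.
congr (_ + _ + _); rewrite -[RHS]mulr1 -[X in _ = _ * X]mu1 -expectZ.
by apply: eq_expect; apply: almostT => x; rewrite mulr1.
Qed.

Lemma nonneg_bind X Y (mu : seq (R * X)) (k : X -> seq (R * Y)) :
  nonneg_weights mu -> almost (fun x => nonneg_weights (k x)) mu ->
  nonneg_weights (dbind mu k).
Proof.
elim: mu => [//|w mu IH] /=.
move=> /andP[w0 mu0] [kw /(IH mu0) IH'].
rewrite dbind_cons /nonneg_weights all_cat -/(nonneg_weights (dbind mu k)) IH'.
rewrite andbT all_map; have [->|/kw] := eqVneq w.1 0.
  by elim: (k w.2) => //= w' l ->; rewrite mul0r lexx.
by elim: (k w.2) => //= w' l IHl /andP[w'0 /IHl ->]; rewrite mulr_ge0.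
Qed.

Lemma almost_impl X (P Q : X -> Prop) (mu : seq (R * X)) :
  (forall x, P x -> Q x) -> almost P mu -> almost Q mu.
Proof.
by move=> PQ; elim: mu => //= w mu IH [Pw /IH]; split=> // /Pw /PQ.
Qed.

Lemma is_distr_bind X Y (mu : seq (R * X)) (k : X -> seq (R * Y)) :
  is_distr mu -> almost (fun x => is_distr (k x)) mu -> is_distr (dbind mu k).
Proof.
move=> [mu0 mu1] kP; split.
  by apply: nonneg_bind => //; apply: almost_impl kP => x [].
rewrite expect_bind -[RHS]mu1; apply: eq_expect.
by apply: almost_impl kP => x [].
Qed.

Lemma is_distr_ret X (x : X) : is_distr [:: (1, x)].
Proof. by split; rewrite ?expect1 //= /nonneg_weights /= ler01. Qed.

Lemma expect_map X Y (u : X -> Y) (mu : seq (R * X)) g :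
  expect [seq (w.1, u w.2) | w <- mu] g = expect mu (g \o u).
Proof. by rewrite /expect big_map. Qed.

Lemma expect_filter X (mu : seq (R * X)) g :
  expect [seq w <- mu | w.1 != 0] g = expect mu g.
Proof.
rewrite /expect big_filter big_mkcond /=; apply: eq_bigr => w _.
by case: eqP => //= ->; rewrite mul0r.
Qed.

Lemma expect_enum (I : finType) (p : I -> R) g :
  expect [seq (p x, x) | x <- enum I] g = \sum_x p x * g x.
Proof. by rewrite /expect big_map big_enum. Qed.

Lemma almost_enum (I : finType) (p : I -> R) (P : I -> Prop) :
  (forall x, p x != 0 -> P x) -> almost P [seq (p x, x) | x <- enum I].
Proof. by move=> pP; elim: (enum I) => //= x s; split=> // /pP. Qed.

End WeightedLists.

(** * A program logic for lower bounds on expectations *)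

Section WeakestPrecondition.
Variables (R : realType) (m n : nat) (A : 'M[R[i]]_(m, n)) (b : 'cV[R[i]]_m).
Local Notation run := (run A b).
Local Notation step := (step A b).
Local Notation exec := (exec A b).
Local Notation memory := (memory R).

Lemma runS T c : run T.+1 c = dbind (step c) (run T).
Proof. by []. Qed.

Lemma run_halted T c : halted c -> run T c = [:: (1, c)].
Proof.
case: c => -[|//] s q _; elim: T => // T IH.
by rewrite runS /= dbind1 IH.
Qed.

Lemma run_stable T c : all (fun w => halted w.2) (run T c) ->
  run T.+1 c = run T c.
Proof.
elim: T c => [|T IH] c.
  by move=> /andP[h _]; rewrite !run_halted.
rewrite !runS.
elim: (step c) => [//|w l IHl]; rewrite !dbind_cons all_cat => /andP[h /IHl ->].
by rewrite IH //; move: h; rewrite all_map; apply: sub_all.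
Qed.

(** A step makes at most one query, so a time bound is also a query bound. *)
Lemma run_queries T c :
  all (fun w => queries w.2 <= queries c + T)%N (run T c).
Proof.
elim: T c => [|T IH] c; first by rewrite /= addn0 leqnn.
have stepq : all (fun w => queries w.2 <= queries c + 1)%N (step c).
  case: c => -[|[a|P1 P2|t P1 P2|t P1] K] s q /=; rewrite ?leq_addr //.
  by elim: (exec a s) => //= w l IHl; case: ifP => //= _; rewrite IHl leq_add2l leq_b1.
rewrite runS; elim: (step c) stepq => //= w l IHl /andP[wq /IHl IHl'].
rewrite dbind_cons all_cat IHl' andbT all_map; apply: sub_all (IH w.2) => w' /= h.
by rewrite (leq_trans h) // addnS -addSn leq_add2r -addn1.
Qed.

(* In continuation-passing style: [K] is the stack of programs still to be run, and
   [v] bounds the final expectation of [f] from below. *)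
Definition wp (f : memory -> R) (T : nat) (K : seq program) (s : memory) (v : R)
  : Prop :=
  forall q, all (fun w => halted w.2) (run T (Config K s q)) /\
            v <= expect (run T (Config K s q)) (fun c => f (Defs.mem c)).

Variable f : memory -> R.

Lemma wp_nil T s v : v <= f s -> wp f T [::] s v.
Proof. by move=> vf q; rewrite run_halted // expect1 /=. Qed.

(** Halted configurations idle, so time may be padded; later lemmas can state rounded bounds. *)
Lemma wp_time T T' K s v : (T <= T')%N -> wp f T K s v -> wp f T' K s v.
Proof.
move=> /subnK <- h q; elim: (T' - T)%N => [|d [IH1 IH2]]; first exact: h.
by rewrite addSn run_stable.
Qed.

Lemma wp_step1 T K K' s v :
  (forall q, step (Config K s q) = [:: (1, Config K' s q)]) ->
  wp f T K' s v -> wp f T.+1 K s v.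
Proof. by move=> E h q; rewrite runS E dbind1; apply: h. Qed.

Lemma wp_seq T P1 P2 K s v :
  wp f T [:: P1, P2 & K] s v -> wp f T.+1 (Seq P1 P2 :: K) s v.
Proof. exact: wp_step1. Qed.

Lemma wp_if T t P1 P2 K s v :
  wp f T ((if eval_test t s then P1 else P2) :: K) s v ->
  wp f T.+1 (If t P1 P2 :: K) s v.
Proof. exact: wp_step1. Qed.

Lemma wp_while T t P1 K s v : eval_test t s ->
  wp f T [:: P1, While t P1 & K] s v -> wp f T.+1 (While t P1 :: K) s v.
Proof. by move=> h; apply: wp_step1 => q /=; rewrite h. Qed.

Lemma wp_while_end T t P1 K s v : ~~ eval_test t s ->
  wp f T K s v -> wp f T.+1 (While t P1 :: K) s v.
Proof. by move=> h; apply: wp_step1 => q /=; rewrite (negPf h). Qed.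

(** The map [u] separates the sampled value from the memory it is written to, so [mu] can be a
    distribution on bare indices, free of machine state. *)
Lemma wp_sample X (mu : seq (R * X)) (u : X -> memory) T a K s g :
  exec a s = [seq (w.1, u w.2) | w <- mu] -> nonneg_weights mu ->
  almost (fun x => wp f T K (u x) (g x)) mu ->
  wp f T.+1 (Instr a :: K) s (expect mu g).
Proof.
move=> E mu0 h q; rewrite runS /= E filter_map; split; last first.
  rewrite expect_bind (expect_map (fun s' => Config K s' (q + is_query a)%N)).
  rewrite (expect_map u) expect_filter.
  by apply: le_expect => //; apply: almost_impl h => x /(_ (q + is_query a)%N)[].
elim: mu {E mu0} h => //= w mu IH [hw /IH h]; case: ifP => //= w0.
rewrite dbind_cons all_cat h andbT all_map.
by have [+ _] := hw w0 (q + is_query a)%N; apply: sub_all.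
Qed.

Lemma wp_instr T a K s s' v : exec a s = [:: (1, s')] ->
  wp f T K s' v -> wp f T.+1 (Instr a :: K) s v.
Proof.
move=> E h q; rewrite runS /= E /= oner_eq0 /= dbind1.
exact: h.
Qed.

End WeakestPrecondition.

(** * Complex moduli and Frobenius norms *)

Section ComplexFacts.
Variable R : realType.
Local Notation C := R[i].
Local Open Scope complex_scope.
Import Normc.

Lemma normc_sqr (z : C) : normc z ^+ 2 = complex.Re z ^+ 2 + complex.Im z ^+ 2.
Proof. by case: z => x y; rewrite /normc sqr_sqrtr // addr_ge0 // sqr_ge0. Qed.

Lemma normc_ge0 (z : C) : 0 <= normc z.
Proof. by case: z => x y; apply: sqrtr_ge0. Qed.

Lemma conjCE (z : C) : Num.conj z = z^*.
Proof. by []. Qed.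

Lemma mul_conjC (z : C) : Num.conj z * z = (normc z ^+ 2)%:C.
Proof. by rewrite normc_sqr; case: z => x y; rewrite conjCE; simpc; congr (_ +i* _); ring. Qed.

Lemma normc_real (x : R) : normc x%:C = `|x|.
Proof. by rewrite /= expr0n addr0 sqrtr_sqr. Qed.

Lemma normc_conj (z : C) : normc (Num.conj z) = normc z.
Proof. by case: z => x y /=; rewrite sqrrN. Qed.

Lemma normc_conjc (z : C) : normc (conjc z) = normc z.
Proof. exact: normc_conj. Qed.

Lemma normc_eq0 (z : C) : (normc z == 0) = (z == 0).
Proof. by apply/eqP/eqP => [/eq0_normc|->] //; rewrite normc0. Qed.

Lemma Re_le_normc (z : C) : complex.Re z <= normc z.
Proof.
case: z => x y /=; rewrite (le_trans (ler_norm x)) // -sqrtr_sqr ler_wsqrtr //.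
by rewrite lerDl sqr_ge0.
Qed.

Lemma le_normc_sum (I : Type) (r : seq I) (F : I -> C) :
  normc (\sum_(i <- r) F i) <= \sum_(i <- r) normc (F i).
Proof.
elim/big_ind2: _ => [|z x z' x' zx zx'|//]; first by rewrite normc0.
by rewrite (le_trans (le_normcD _ _)) // lerD.
Qed.

Lemma Re_sum (I : Type) (r : seq I) (P : pred I) (F : I -> C) :
  complex.Re (\sum_(i <- r | P i) F i) = \sum_(i <- r | P i) complex.Re (F i).
Proof.
elim/big_ind2: _ => [//|x z y t <- <-|//].
by case: z t => [? ?] [? ?].
Qed.

Lemma Re_realM (x : R) (z : C) : complex.Re (x%:C * z) = x * complex.Re z.
Proof. by case: z => y t /=; rewrite mul0r subr0. Qed.

Lemma ReB (z t : C) : complex.Re (z - t) = complex.Re z - complex.Re t.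
Proof. by case: z t => [? ?] [? ?]. Qed.

Lemma sum_sqr_ge0 (I : finType) (a : I -> R) : 0 <= \sum_i a i ^+ 2.
Proof. by apply: sumr_ge0 => i _; rewrite sqr_ge0. Qed.

(** Lagrange's identity: the double sum of squares in the proof is twice the difference of the two
    sides. *)
Lemma cauchy_schwarz_sum (I : finType) (a c : I -> R) :
  (\sum_i a i * c i) ^+ 2 <= (\sum_i a i ^+ 2) * (\sum_i c i ^+ 2).
Proof.
have: 0 <= \sum_i \sum_j (a i * c j - a j * c i) ^+ 2.
  by apply: sumr_ge0 => i _; apply: sum_sqr_ge0.
have -> : \sum_i \sum_j (a i * c j - a j * c i) ^+ 2 =
    \sum_i \sum_j a i ^+ 2 * c j ^+ 2 + \sum_i \sum_j a j ^+ 2 * c i ^+ 2 -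
    2 * \sum_i \sum_j (a i * c i) * (a j * c j).
  rewrite mulr_sumr -big_split -sumrB /=; apply: eq_bigr => i _.
  rewrite mulr_sumr -big_split -sumrB /=; apply: eq_bigr => j _; ring.
rewrite [X in _ + X - _]exchange_big /= -!big_distrlr /=.
by rewrite -expr2; lra.
Qed.

Lemma frobenius_sqr m n (A : 'M[C]_(m, n)) :
  frobenius_norm A ^+ 2 = \sum_i \sum_j normc (A i j) ^+ 2.
Proof.
by rewrite sqr_sqrtr //; apply: sumr_ge0 => i _; apply: sum_sqr_ge0.
Qed.

Lemma frobenius_ge0 m n (A : 'M[C]_(m, n)) : 0 <= frobenius_norm A.
Proof. exact: sqrtr_ge0. Qed.

Lemma frobenius_row_sqr n (y : 'rV[C]_n) :
  frobenius_norm y ^+ 2 = \sum_j normc (y 0 j) ^+ 2.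
Proof. by rewrite frobenius_sqr big_ord1. Qed.

Lemma frobenius_col_sqr n (x : 'cV[C]_n) :
  frobenius_norm x ^+ 2 = \sum_j normc (x j 0) ^+ 2.
Proof. by rewrite frobenius_sqr; apply: eq_bigr => j _; rewrite big_ord1. Qed.

Lemma frobenius_rows m n (A : 'M[C]_(m, n)) :
  frobenius_norm A ^+ 2 = \sum_i frobenius_norm (row i A) ^+ 2.
Proof.
rewrite frobenius_sqr; apply: eq_bigr => i _; rewrite frobenius_row_sqr.
by apply: eq_bigr => j _; rewrite mxE.
Qed.

Lemma normc_le_frobenius m n (A : 'M[C]_(m, n)) i j :
  normc (A i j) <= frobenius_norm A.
Proof.
rewrite -(ler_pXn2r (_ : (0 < 2)%N)) ?nnegrE ?normc_ge0 ?frobenius_ge0 //.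
rewrite frobenius_sqr (bigD1 i) //= (bigD1 j) //= -addrA lerDl addr_ge0 //.
  by apply: sumr_ge0 => *; rewrite sqr_ge0.
by apply: sumr_ge0 => *; apply: sum_sqr_ge0.
Qed.

Lemma frobenius_eq0 m n (A : 'M[C]_(m, n)) : (frobenius_norm A == 0) = (A == 0).
Proof.
apply/eqP/eqP => [A0|->].
  apply/matrixP => i j; rewrite mxE; apply/eqP; rewrite -normc_eq0.
  by rewrite eq_le normc_ge0 andbT -A0 normc_le_frobenius.
apply/eqP; rewrite -sqrf_eq0 frobenius_sqr big1 // => i _.
by rewrite big1 // => j _; rewrite mxE normc0 expr0n.
Qed.

Lemma frobenius_gt0 m n (A : 'M[C]_(m, n)) : A != 0 -> 0 < frobenius_norm A.
Proof. by rewrite lt_def frobenius_eq0 frobenius_ge0 andbT. Qed.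

Lemma normc_mulmx m n p (A : 'M[C]_(m, n)) (B : 'M[C]_(n, p)) i j :
  normc ((A *m B) i j) ^+ 2 <=
  frobenius_norm (row i A) ^+ 2 * frobenius_norm (col j B) ^+ 2.
Proof.
rewrite mxE (le_trans (y := (\sum_k normc (A i k) * normc (B k j)) ^+ 2)) //.
  rewrite ler_pXn2r ?nnegrE ?normc_ge0 //; last first.
    by apply: sumr_ge0 => k _; rewrite mulr_ge0 ?normc_ge0.
  rewrite (le_trans (le_normc_sum _ _)) //.
  by apply: ler_sum => k _; rewrite normcM.
rewrite (le_trans (cauchy_schwarz_sum _ _)) // frobenius_row_sqr frobenius_col_sqr.
rewrite le_eqVlt; apply/orP; left; apply/eqP.
by congr (_ * _); apply: eq_bigr => k _; rewrite mxE.
Qed.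

Lemma frobenius_mulmx m n p (A : 'M[C]_(m, n)) (B : 'M[C]_(n, p)) :
  frobenius_norm (A *m B) <= frobenius_norm A * frobenius_norm B.
Proof.
rewrite -(ler_pXn2r (_ : (0 < 2)%N)) ?nnegrE ?mulr_ge0 ?frobenius_ge0 //.
rewrite exprMn frobenius_sqr frobenius_rows mulr_suml; apply: ler_sum => i _.
rewrite (le_trans (ler_sum _ (fun j _ => normc_mulmx A B i j))) //.
rewrite -mulr_sumr ler_wpM2l ?sqr_ge0 //.
rewrite frobenius_sqr exchange_big; apply: ler_sum => j _.
by rewrite frobenius_col_sqr; apply: ler_sum => k _; rewrite mxE.
Qed.

Lemma frobeniusZ m n (a : R) (A : 'M[C]_(m, n)) :
  frobenius_norm (a%:C *: A) = `|a| * frobenius_norm A.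
Proof.
apply/eqP; rewrite -(eqrXn2 (_ : (0 < 2)%N)) ?mulr_ge0 ?frobenius_ge0 //.
rewrite exprMn !frobenius_sqr mulr_sumr; apply/eqP; apply: eq_bigr => i _.
by rewrite mulr_sumr; apply: eq_bigr => j _; rewrite mxE normcM normc_real exprMn.
Qed.

End ComplexFacts.

(** * Singular values and decay of the mean error *)

Section SingularValues.
Variable R : realType.
Local Notation C := R[i].
Local Open Scope complex_scope.
Local Open Scope sesquilinear_scope.
Local Open Scope classical_set_scope.
Import Normc.

Lemma frobenius_trace m n (A : 'M[C]_(m, n)) :
  (frobenius_norm A ^+ 2)%:C = \tr (A^t* *m A).
Proof.
rewrite frobenius_sqr exchange_big /= rmorph_sum; apply: eq_bigr => j _.
rewrite mxE rmorph_sum; apply: eq_bigr => i _.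
by rewrite !mxE mul_conjC.
Qed.

Lemma frobenius_trmxC m n (A : 'M[C]_(m, n)) :
  frobenius_norm (A^t*) = frobenius_norm A.
Proof.
congr Num.sqrt; rewrite exchange_big; apply: eq_bigr => i _; apply: eq_bigr => j _.
by rewrite !mxE normc_conj.
Qed.

Lemma frobenius_unitary_col m k (U : 'M[C]_(m, k)) j :
  U^t* *m U = 1%:M -> frobenius_norm (col j U) = 1.
Proof.
move=> /matrixP/(_ j j); rewrite !mxE eqxx => UU.
apply/eqP; rewrite -(@pexpr_eq1 _ _ 2) ?frobenius_ge0 //; apply/eqP.
apply: complexI; rewrite rmorph1 -[RHS]UU frobenius_col_sqr rmorph_sum.
by apply: eq_bigr => i _; rewrite !mxE mul_conjC.
Qed.

Definition real_diag k (s : 'I_k -> R) : 'M[C]_k := diag_mx (\row_i (s i)%:C).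

Lemma real_diag_trmxC k (s : 'I_k -> R) : (real_diag s)^t* = real_diag s.
Proof.
rewrite /real_diag tr_diag_mx map_diag_mx; congr diag_mx; apply/rowP => i.
by rewrite !mxE; apply: conjc_real.
Qed.

Lemma real_diagM k (s t : 'I_k -> R) :
  real_diag s *m real_diag t = real_diag (fun i => s i * t i).
Proof.
rewrite /real_diag mulmx_diag; congr diag_mx; apply/rowP => i.
by rewrite !mxE rmorphM.
Qed.

Lemma real_diag1 k (s : 'I_k -> R) : (forall i, s i = 1) -> real_diag s = 1%:M.
Proof.
move=> s1; rewrite -diag_const_mx; congr diag_mx; apply/rowP => i.
by rewrite !mxE s1 rmorph1.
Qed.

Lemma mulmx_real_diag m k (U : 'M[C]_(m, k)) (s : 'I_k -> R) i j :
  (U *m real_diag s) i j = U i j * (s j)%:C.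
Proof. by rewrite /real_diag mul_mx_diag !mxE. Qed.

Lemma col_mulmx m n p j (A : 'M[C]_(m, n)) (B : 'M[C]_(n, p)) :
  col j (A *m B) = A *m col j B.
Proof. by rewrite !colE mulmxA. Qed.

Section Svd.
Variables (m n k : nat) (A : 'M[C]_(m, n)) (s : 'I_k -> R).
Variables (U : 'M[C]_(m, k)) (V : 'M[C]_(n, k)).
Hypothesis AUV : is_svd A s U V.

Let UU : U^t* *m U = 1%:M. Proof. by case: AUV. Qed.
Let VV : V^t* *m V = 1%:M. Proof. by case: AUV. Qed.
Let s_gt0 j : 0 < s j. Proof. by case: AUV. Qed.

Lemma svd_mx : A = U *m real_diag s *m V^t*.
Proof. by case: AUV => _ _ _ {1}->; rewrite sum_outer. Qed.

Lemma pinv_mx :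
  pseudo_inverse A = V *m real_diag (fun i => (s i)^-1) *m U^t*.
Proof. by rewrite (pseudo_inverseE AUV) /svd_pinv sum_outer. Qed.

Lemma svd_gram : A^t* *m A = V *m real_diag (fun i => s i ^+ 2) *m V^t*.
Proof.
rewrite svd_mx !trmx_mul !map_mxM trmxCK real_diag_trmxC !mulmxA.
by rewrite -(mulmxA _ _ U) UU mulmx1 -[V *m _ *m real_diag s]mulmxA real_diagM.
Qed.

Lemma svd_frobenius : frobenius_norm A ^+ 2 = \sum_j s j ^+ 2.
Proof.
apply: complexI; rewrite frobenius_trace svd_gram -mulmxA mxtrace_mulC.
rewrite -mulmxA VV mulmx1 rmorph_sum.
by apply: eq_bigr => i _; rewrite !mxE eqxx.
Qed.

Lemma svd_mul_right j : A *m col j V = (s j)%:C *: col j U.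
Proof.
rewrite -col_mulmx svd_mx -!mulmxA VV mulmx1.
by apply/colP => i; rewrite mxE mulmx_real_diag !mxE mulrC.
Qed.

Lemma pinv_mul_left j :
  pseudo_inverse A *m col j U = (s j)^-1%:C *: col j V.
Proof.
rewrite -col_mulmx pinv_mx -!mulmxA UU mulmx1.
by apply/colP => i; rewrite mxE mulmx_real_diag !mxE mulrC.
Qed.

(** Compressing [A] between [U] and [V] leaves an invertible diagonal matrix of size [k], and
    products cannot raise the rank. This turns sums over singular values into multiples of the
    parameter [\rank A]. *)
Lemma svd_rank : (k <= \rank A)%N.
Proof.
have E : U^t* *m A *m V = real_diag s.
  by rewrite svd_mx !mulmxA UU mul1mx -mulmxA VV mulmx1.
have DI : real_diag s *m real_diag (fun i => (s i)^-1) = 1%:M.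
  by rewrite real_diagM real_diag1 // => i; rewrite divff // gt_eqF.
have [Du _] := mulmx1_unit DI.
rewrite -{1}(mxrank_unit Du) -E.
by rewrite (leq_trans (mxrankM_maxl _ _)) // mxrankM_maxr.
Qed.

Lemma svd_value_le_frobenius j : s j <= frobenius_norm A.
Proof.
rewrite -(ler_pXn2r (_ : (0 < 2)%N)) ?nnegrE ?frobenius_ge0 ?(ltW (s_gt0 j)) //.
by rewrite svd_frobenius (bigD1 j) //= lerDl sumr_ge0 // => i _; rewrite sqr_ge0.
Qed.

(** The right-hand side is the same for every decomposition, so one bound applies to the whole set
    whose infimum is [sigma_min A]. *)
Lemma svd_inv_le_pinv j : (s j)^-1 <= frobenius_norm (pseudo_inverse A).
Proof.
have := frobenius_mulmx (pseudo_inverse A) (col j U).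
rewrite pinv_mul_left frobeniusZ !frobenius_unitary_col // !mulr1.
by rewrite ger0_norm // invr_ge0 ltW.
Qed.

Lemma sigma_min_le j : sigma_min A <= s j.
Proof.
apply: ge_inf; last by exists k, s, U, V; split=> //; exists j.
by exists 0 => x [k' [s' [U' [V' [[_ _ s'0 _] [i ->]]]]]]; rewrite ltW.
Qed.

(* In expectation, one Kaczmarz step multiplies the error by this matrix. *)
Definition kaczmarz_mean : 'M[C]_n :=
  1%:M - (frobenius_norm A ^- 2)%:C *: (A^t* *m A).
Local Notation G := kaczmarz_mean.

(** [V^t*] intertwines the mean matrix with a diagonal one. It also annihilates the part of [u]
    orthogonal to the columns of [V], which the mean matrix leaves fixed and would never
    contract. *)
Lemma svd_iter_mean T (u : 'cV[C]_n) :
  V^t* *m iter T (mulmx G) u =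
  real_diag (fun j => (1 - s j ^+ 2 / frobenius_norm A ^+ 2) ^+ T) *m (V^t* *m u).
Proof.
elim: T => [|T IH] /=.
  by rewrite real_diag1 ?mul1mx // => i; rewrite expr0.
have VG : V^t* *m G =
    real_diag (fun j => 1 - s j ^+ 2 / frobenius_norm A ^+ 2) *m V^t*.
  rewrite mulmxBr mulmx1 -scalemxAr svd_gram !mulmxA VV mul1mx.
  apply/matrixP => i j; rewrite /real_diag !mul_diag_mx !mxE.
  by move: (s i ^+ 2) (_ ^- 2) => x y; rewrite rmorphB rmorphM rmorph1; ring.
rewrite mulmxA VG -mulmxA IH mulmxA real_diagM.
by congr (real_diag _ *m _); apply/funext => j; rewrite [RHS]exprS.
Qed.

Lemma conj_pinv_mul (b : 'cV[C]_m) : (pseudo_inverse A *m b)^t* =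
  b^t* *m U *m real_diag (fun i => (s i)^-1) *m V^t*.
Proof.
by rewrite pinv_mx !trmx_mul !map_mxM trmxCK real_diag_trmxC !mulmxA.
Qed.

(** The part of [b] outside the range of [A] is orthogonal to the columns of [A]. Hence the target
    is a fixed point of the mean iteration even when no exact solution exists. *)
Lemma normal_equation (b : 'cV[C]_m) : (pseudo_inverse A *m b)^t* *m (A^t* *m A) = b^t* *m A.
Proof.
rewrite conj_pinv_mul svd_gram [in RHS]svd_mx !mulmxA; congr (_ *m _).
rewrite -(mulmxA _ _ V) VV mulmx1 -!mulmxA real_diagM.
congr (_ *m (_ *m real_diag _)); apply/funext => i.
by rewrite expr2 mulKf // gt_eqF.
Qed.

(** The target is expanded over the singular directions: the coefficients of [b] and [u] are at most
    their norms by Cauchy-Schwarz, the singular vectors being unit vectors. *)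
Lemma kaczmarz_bias_sum (b : 'cV[C]_m) T (u : 'cV[C]_n) :
  normc (((pseudo_inverse A *m b)^t* *m iter T (mulmx G) u) 0 0) <=
  \sum_j (s j)^-1 * (1 - s j ^+ 2 / frobenius_norm A ^+ 2) ^+ T *
    (frobenius_norm b * frobenius_norm u).
Proof.
rewrite conj_pinv_mul -mulmxA svd_iter_mean [_ *m (real_diag _ *m _)]mulmxA.
rewrite -[_ *m real_diag _ *m real_diag _]mulmxA real_diagM mxE.
rewrite (le_trans (le_normc_sum _ _)) //; apply: ler_sum => j _.
have Fge := svd_value_le_frobenius j; have sj := s_gt0 j.
have F_gt0 := lt_le_trans sj Fge.
rewrite mulmx_real_diag !normcM normc_real mulrAC mulrC ger0_norm; last first.
  rewrite mulr_ge0 ?invr_ge0 ?(ltW sj) // exprn_ge0 // subr_ge0.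
  by rewrite ler_pdivrMr ?exprn_gt0 // mul1r ler_pXn2r ?nnegrE ?(ltW sj) ?(ltW F_gt0).
rewrite ler_wpM2l //.
  rewrite mulr_ge0 ?invr_ge0 ?(ltW sj) // exprn_ge0 // subr_ge0.
  by rewrite ler_pdivrMr ?exprn_gt0 // mul1r ler_pXn2r ?nnegrE ?(ltW sj) ?(ltW F_gt0).
have le p q (B : 'M[C]_(p, q)) i l x y : normc (B i l) ^+ 2 <= x ^+ 2 * y ^+ 2 ->
    0 <= x -> 0 <= y -> normc (B i l) <= x * y.
  move=> h x0 y0; rewrite -(ler_pXn2r (_ : (0 < 2)%N)) ?nnegrE ?normc_ge0 ?mulr_ge0 //.
  by rewrite exprMn.
rewrite ler_pM ?normc_ge0 //.
  rewrite -[leRHS]mulr1; apply: le => //; rewrite ?frobenius_ge0 //.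
  rewrite (le_trans (normc_mulmx _ _ _ _)) // frobenius_unitary_col //.
  by rewrite -(frobenius_trmxC b) row_id.
rewrite -[leRHS]mul1r; apply: le => //; rewrite ?frobenius_ge0 //.
rewrite (le_trans (normc_mulmx _ _ _ _)) // col_id.
rewrite -(frobenius_trmxC (row j _)) (_ : (row j _)^t* = col j V).
  by rewrite frobenius_unitary_col.
by apply/colP => i; rewrite !mxE conjCK.
Qed.

End Svd.

Lemma frobenius_le_spectral m n (A : 'M[C]_(m, n)) (x : 'cV[C]_n) :
  frobenius_norm x <= 1 -> frobenius_norm (A *m x) <= spectral_norm A.
Proof.
move=> x1; apply: ub_le_sup; last by exists x.
exists (frobenius_norm A) => _ [y /= y1 <-].
by rewrite (le_trans (frobenius_mulmx _ _)) // ler_piMr ?frobenius_ge0.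
Qed.

Lemma spectral_le_frobenius m n (A : 'M[C]_(m, n)) :
  spectral_norm A <= frobenius_norm A.
Proof.
apply: ge_sup => [|_ [y /= y1 <-]]; last first.
  by rewrite (le_trans (frobenius_mulmx _ _)) // ler_piMr ?frobenius_ge0.
exists (frobenius_norm (A *m (0 : 'cV_n))), 0 => //=.
by have /eqP -> : frobenius_norm (0 : 'cV[C]_n) == 0 by rewrite frobenius_eq0.
Qed.

Lemma svd_value_le_spectral m n k (A : 'M[C]_(m, n)) (s : 'I_k -> R) U V j :
  is_svd A s U V -> s j <= spectral_norm A.
Proof.
move=> AUV; have [UU VV s0 _] := AUV.
have := @frobenius_le_spectral _ _ A (col j V).
rewrite (svd_mul_right AUV) frobeniusZ !frobenius_unitary_col // mulr1.
by rewrite gtr0_norm //; apply.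
Qed.

Lemma svd_nonempty m n k (A : 'M[C]_(m, n)) (s : 'I_k -> R) U V :
  A != 0 -> is_svd A s U V -> exists j : 'I_k, True.
Proof.
case: k s U V => [|k] s U V A0 AUV; last by exists ord0.
by case/eqP: A0; case: AUV => _ _ _ ->; rewrite big_ord0.
Qed.

Lemma spectral_gt0 m n (A : 'M[C]_(m, n)) : A != 0 -> 0 < spectral_norm A.
Proof.
move=> A0; have [k [s [U [V AUV]]]] := svd_exists A.
have [j _] := svd_nonempty A0 AUV.
by apply: lt_le_trans (svd_value_le_spectral j AUV); case: AUV.
Qed.

(* Every singular value, of any decomposition, is at least 1 / ||A^-1||_F. *)
Lemma sigma_min_gt0 m n (A : 'M[C]_(m, n)) : A != 0 -> 0 < sigma_min A.
Proof.
move=> A0; have [k [s [U [V AUV]]]] := svd_exists A.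
have [j _] := svd_nonempty A0 AUV; have [_ _ s0 _] := AUV.
have p0 : 0 < frobenius_norm (pseudo_inverse A).
  by apply: lt_le_trans (svd_inv_le_pinv AUV j); rewrite invr_gt0.
apply: (lt_le_trans (y := (frobenius_norm (pseudo_inverse A))^-1)).
  by rewrite invr_gt0.
apply: lb_le_inf; first by exists (s j), k, s, U, V; split=> //; exists j.
move=> x [k' [s' [U' [V' [AUV' [i ->]]]]]].
have [_ _ s'0 _] := AUV'.
by rewrite -[leRHS]invrK lef_pV2 ?posrE ?invr_gt0 // (svd_inv_le_pinv AUV').
Qed.

Lemma condition_number_ge0 m n (A : 'M[C]_(m, n)) :
  A != 0 -> 0 <= condition_number A.
Proof.
by move=> A0; rewrite divr_ge0 ?(ltW (spectral_gt0 A0)) ?(ltW (sigma_min_gt0 A0)).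
Qed.

(** The square of the Frobenius norm is a sum of at most [\rank A] squared singular values, each at
    most the squared spectral norm. *)
Lemma frobenius_le_cond m n k (A : 'M[C]_(m, n)) (s : 'I_k -> R) U V j :
  A != 0 -> is_svd A s U V ->
  frobenius_norm A ^+ 2 / s j ^+ 2 <= (\rank A)%:R * condition_number A ^+ 2.
Proof.
move=> A0 AUV; have [_ _ s0 _] := AUV; have p0 := spectral_gt0 A0.
have F_le : frobenius_norm A ^+ 2 <= (\rank A)%:R * spectral_norm A ^+ 2.
  rewrite (svd_frobenius AUV).
  apply: (le_trans (y := k%:R * spectral_norm A ^+ 2)).
    rewrite mulrC mulr_natr -[k in leRHS]card_ord -sumr_const; apply: ler_sum => i _.
    by rewrite ler_pXn2r ?nnegrE ?(ltW (s0 i)) ?(ltW p0) // (svd_value_le_spectral _ AUV).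
  by rewrite ler_wpM2r ?sqr_ge0 // ler_nat (svd_rank AUV).
have m0 := sigma_min_gt0 A0.
rewrite exprMn mulrA exprVn ler_pM ?sqr_ge0 ?invr_ge0 ?sqr_ge0 //.
rewrite lef_pV2 ?posrE ?exprn_gt0 // ler_pXn2r ?nnegrE ?(ltW m0) ?(ltW (s0 j)) //.
exact: (sigma_min_le AUV).
Qed.

(** By induction [(1 - a) ^ t * (1 + t a) <= 1]. Weaker than exponential decay, but solving it for
    [T] takes only arithmetic and keeps [T] polynomial. *)
Lemma expr_sub_le_inv (a : R) T : 0 < a <= 1 -> (0 < T)%N ->
  (1 - a) ^+ T <= (T%:R * a)^-1.
Proof.
move=> /andP[a0 a1] T0.
have h t : (1 - a) ^+ t * (1 + t%:R * a) <= 1.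
  elim: t => [|t IH]; first by rewrite expr0 mul0r addr0 mulr1.
  apply: le_trans IH; rewrite exprSr -mulrA ler_wpM2l ?exprn_ge0 ?subr_ge0 //.
  have t0 : 0 <= t%:R :> R by [].
  by rewrite -natr1; nra.
have Ta : 0 < T%:R * a by rewrite mulr_gt0 // ltr0n.
rewrite -div1r ler_pdivlMr //; apply: le_trans (h T).
by rewrite ler_wpM2l ?exprn_ge0 ?subr_ge0 // lerDr.
Qed.

Lemma kaczmarz_bias m n (A : 'M[C]_(m, n)) (b : 'cV[C]_m) T (u : 'cV[C]_n) :
  A != 0 -> (0 < T)%N -> frobenius_norm u <= 1 ->
  normc (((pseudo_inverse A *m b)^t* *m iter T (mulmx (kaczmarz_mean A)) u) 0 0) <=
  (\rank A)%:R * (frobenius_norm b / frobenius_norm A) *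
    ((\rank A)%:R * condition_number A ^+ 2) ^+ 2 / T%:R.
Proof.
move=> A0 T0 u1; have [k [s [U [V AUV]]]] := svd_exists A.
apply: le_trans (kaczmarz_bias_sum AUV b T u) _.
set K := _ * condition_number A ^+ 2; set F := frobenius_norm A.
have F0 : 0 < F by apply: frobenius_gt0.
have [_ _ s0 _] := AUV; have b0 := frobenius_ge0 b; have T0' : 0 < T%:R :> R by rewrite ltr0n.
have term j : (s j)^-1 * (1 - s j ^+ 2 / F ^+ 2) ^+ T * (frobenius_norm b * frobenius_norm u)
    <= frobenius_norm b / F * K ^+ 2 / T%:R.
  have sF : s j <= F := svd_value_le_frobenius AUV j; have sj := s0 j.
  pose h := F / s j; have h1 : 1 <= h by rewrite ler_pdivlMr // mul1r.
  have hK : h ^+ 2 <= K by rewrite expr_div_n; exact: (frobenius_le_cond j A0 AUV).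
  have h0 : 0 <= h by apply: le_trans h1.
  have a01 : 0 < s j ^+ 2 / F ^+ 2 <= 1.
    rewrite divr_gt0 ?exprn_gt0 //= ler_pdivrMr ?exprn_gt0 // mul1r.
    by rewrite ler_pXn2r ?nnegrE ?(ltW sj) ?(ltW F0).
  apply: (le_trans (y := (s j)^-1 * (T%:R * (s j ^+ 2 / F ^+ 2))^-1 * frobenius_norm b)).
    rewrite ler_pM ?mulr_ge0 ?frobenius_ge0 ?invr_ge0 ?(ltW sj) //.
    - by case/andP: a01 => _ a1; rewrite exprn_ge0 ?subr_ge0.
    - by rewrite ler_wpM2l ?invr_ge0 ?(ltW sj) // expr_sub_le_inv.
    - by rewrite ler_piMr.
  have -> : (s j)^-1 * (T%:R * (s j ^+ 2 / F ^+ 2))^-1 * frobenius_norm b =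
      frobenius_norm b / F * h ^+ 3 / T%:R.
    by rewrite /h; field; rewrite !gt_eqF.
  rewrite ler_pM2r ?invr_gt0 // ler_wpM2l ?divr_ge0 ?(ltW F0) //.
  (* The cube is rounded up to a fourth power, using [1 <= h], so that [K ^ 2] appears instead of a
     half-integer power of [K]. *)
  apply: (le_trans (y := (h ^+ 2) ^+ 2)); first by rewrite -exprM ler_weXn2l.
  by rewrite ler_pXn2r ?nnegrE ?sqr_ge0 // (le_trans _ hK) ?sqr_ge0.
apply: le_trans (ler_sum _ (fun j _ => term j)) _.
rewrite sumr_const card_ord -[_ *+ k]mulr_natl.
rewrite [leRHS](_ : _ = (\rank A)%:R * (frobenius_norm b / F * K ^+ 2 / T%:R)); last first.
  by rewrite !mulrA.
rewrite ler_wpM2r //.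
  by rewrite divr_ge0 ?(ltW T0') // mulr_ge0 ?sqr_ge0 // divr_ge0 // ltW.
by rewrite ler_nat (svd_rank AUV).
Qed.

End SingularValues.

(** * First and second moments of the randomized iteration *)

Section RandomizedKaczmarz.
Variables (R : realType) (m n : nat).
Local Notation C := R[i].
Local Open Scope complex_scope.
Local Open Scope sesquilinear_scope.
Import Normc.

Variables (A : 'M[C]_(m, n)) (b : 'cV[C]_m) (T : nat).
Hypotheses (A0 : A != 0) (T0 : (0 < T)%N).

Local Notation F2 := (frobenius_norm A ^+ 2).
Local Notation rownorm2 r := (frobenius_norm (row r A) ^+ 2).

Definition row_distr : seq (R * 'I_m) :=
  [seq (rownorm2 r / F2, r) | r <- enum 'I_m].

Definition col_distr (r : 'I_m) : seq (R * 'I_n) :=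
  [seq (normc (A r j) ^+ 2 / rownorm2 r, j) | j <- enum 'I_n].

(* [y 0 j / A r j] with [j] drawn from [col_distr r] is an unbiased estimator of the
   coefficient of the projection of [y] onto row [r]; [M] of the [T] samples remain. *)
Fixpoint coef_distr (M : nat) (r : 'I_m) (y : 'rV[C]_n) (g : C) : seq (R * C) :=
  if M is M'.+1 then
    dbind (col_distr r) (fun j => coef_distr M' r y (g - y 0 j / (A r j * T%:R)))
  else [:: (1, g)].

(** The list, not the vector, is the state of a run: it is what the machine stores, and its length
    is independent of [n]. *)
Definition combination (l : seq ('I_m * C)) : 'rV[C]_n :=
  \sum_(x <- l) x.2 *: row x.1 A.

(** Iterates are row vectors approaching [(pseudo_inverse A *m b)^t*], so rows of [A] enter without
    conjugation while [b] is conjugated: row [r] asks for [y *m (row r A)^t* = conjc (b r 0)]. *)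
Fixpoint iterate_distr (t : nat) (l : seq ('I_m * C)) : seq (R * seq ('I_m * C)) :=
  if t is t'.+1 then
    dbind row_distr (fun r =>
      dbind (coef_distr T r (combination l) (conjc (b r 0) / (rownorm2 r)%:C))
        (fun g => iterate_distr t' (rcons l (r, g))))
  else [:: (1, l)].

Definition projection_coef (r : 'I_m) (y : 'rV[C]_n) : C :=
  (y *m (row r A)^t*) 0 0 / (rownorm2 r)%:C.

Let F2_gt0 : 0 < F2. Proof. by rewrite exprn_gt0 // frobenius_gt0. Qed.
Let T_gt0 : 0 < T%:R :> R. Proof. by rewrite ltr0n. Qed.
Let TC_neq0 : T%:R != 0 :> C. Proof. by rewrite pnatr_eq0 -lt0n. Qed.

Lemma row_distr_is_distr : is_distr row_distr.
Proof.
split; first by rewrite /nonneg_weights all_map; apply/allP => r _ /=; rewrite divr_ge0 ?sqr_ge0.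
rewrite expect_enum; under eq_bigr do rewrite mulr1.
by rewrite -mulr_suml -frobenius_rows divff // gt_eqF.
Qed.

Lemma row_weight_neq0 r : rownorm2 r / F2 != 0 -> 0 < rownorm2 r.
Proof. by rewrite mulf_eq0 negb_or => /andP[h _]; rewrite lt_def h sqr_ge0. Qed.

Lemma almost_row_distr (P : 'I_m -> Prop) :
  (forall r, 0 < rownorm2 r -> P r) -> almost P row_distr.
Proof. by move=> h; apply: almost_enum => r /row_weight_neq0/h. Qed.

Section OneRow.
Variable r : 'I_m.
Hypothesis r_gt0 : 0 < rownorm2 r.

Lemma col_distr_is_distr : is_distr (col_distr r).
Proof.
split; first by rewrite /nonneg_weights all_map; apply/allP => j _ /=; rewrite divr_ge0 ?sqr_ge0.
rewrite expect_enum; under eq_bigr do rewrite mulr1.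
rewrite -mulr_suml (_ : \sum_j _ = rownorm2 r) ?divff ?gt_eqF //.
by rewrite frobenius_row_sqr; apply: eq_bigr => j _; rewrite mxE.
Qed.

Lemma coef_distr_is_distr M y g : is_distr (coef_distr M r y g).
Proof.
elim: M g => [|M IH] g /=; first exact: is_distr_ret.
by apply: is_distr_bind; [exact: col_distr_is_distr | exact: almostT].
Qed.

(** Sampling weights [|A r j| ^ 2] cancel the denominators [A r j]. Since [expect] takes real
    functions, complex means are expressed by real parts against an arbitrary multiplier [u]. *)
Lemma col_distr_mean (y : 'rV[C]_n) (u : C) :
  expect (col_distr r) (fun j => complex.Re (u * (y 0 j / (A r j * T%:R)))) =
  complex.Re (u * (projection_coef r y / T%:R)).
Proof.
rewrite expect_enum /projection_coef mxE !mulr_suml mulr_sumr Re_sum.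
apply: eq_bigr => j _; rewrite -Re_realM; congr complex.Re; rewrite !mxE.
have rC : (rownorm2 r)%:C != 0 :> C by rewrite gt_eqF // ltcR.
have -> : (normc (A r j) ^+ 2 / rownorm2 r)%:C =
    Num.conj (A r j) * A r j / (rownorm2 r)%:C.
  by rewrite mul_conjC -fmorphV -rmorphM.
move: (rownorm2 r)%:C rC => rn rC; have [->|Arj] := eqVneq (A r j) 0.
  by rewrite !(mul0r, mulr0, rmorph0).
by field; rewrite rC Arj TC_neq0.
Qed.

(** Each column with a nonzero entry contributes its term of the right-hand side exactly; those with
    [A r j = 0] have weight 0, hence an inequality. *)
Lemma col_distr_second_moment (y : 'rV[C]_n) :
  expect (col_distr r) (fun j => normc (y 0 j / (A r j * T%:R)) ^+ 2) <=
  frobenius_norm y ^+ 2 / rownorm2 r / T%:R ^+ 2.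
Proof.
rewrite expect_enum [frobenius_norm y ^+ 2]frobenius_row_sqr !mulr_suml; apply: ler_sum => j _.
have nT : normc (T%:R : C) = T%:R :> R.
  by rewrite -(rmorph_nat (real_complex R)) normc_real normr_nat.
rewrite !(normcM, normcV) nT; have [->|Arj] := eqVneq (normc (A r j)) 0.
  rewrite expr0n !mul0r divr_ge0 ?exprn_ge0 ?(ltW T_gt0) // divr_ge0 ?sqr_ge0 //.
have r0 : rownorm2 r != 0 by rewrite gt_eqF.
rewrite le_eqVlt; apply/orP; left; apply/eqP; field.
have q0 : frobenius_norm (row r A) != 0 by rewrite -sqrf_eq0.
by rewrite Arj q0 gt_eqF.
Qed.

Lemma coef_distr_mean M y g u :
  expect (coef_distr M r y g) (fun x => complex.Re (u * x)) =
  complex.Re (u * (g - M%:R * (projection_coef r y / T%:R))).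
Proof.
elim: M g => [|M IH] g /=; first by rewrite expect1 mul0r subr0.
rewrite expect_bind.
set c := g - M%:R * (projection_coef r y / T%:R).
rewrite (eq_expect (h := fun j => complex.Re (u * c) +
    (-1) * complex.Re (u * (y 0 j / (A r j * T%:R))) + 0 * 0)); last first.
  apply: almostT => j; rewrite IH mulr0 addr0 mulN1r -ReB; congr complex.Re.
  by rewrite /c; ring.
rewrite (expect_affine _ _ _ _ (fun=> 0) col_distr_is_distr) col_distr_mean.
rewrite mul0r addr0 mulN1r -ReB; congr complex.Re.
by rewrite /c -natr1; ring.
Qed.

Lemma normc_sqrB (w z : C) :
  normc (w - z) ^+ 2 = normc w ^+ 2 - 2 * complex.Re (conjc w * z) + normc z ^+ 2.
Proof. by rewrite !normc_sqr; case: w z => [a c] [d e] /=; ring. Qed.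

(** Variances of independent samples add. Each is bounded by the second moment [S] of a sample; the
    squared mean dropped here is what completes the square. *)
Lemma coef_distr_second_moment M y g c :
  expect (coef_distr M r y g) (fun x => normc (x + c) ^+ 2) <=
  normc (g + c - M%:R * (projection_coef r y / T%:R)) ^+ 2 +
  M%:R * (frobenius_norm y ^+ 2 / rownorm2 r / T%:R ^+ 2).
Proof.
elim: M g => [|M IH] g /=; first by rewrite expect1 !mul0r subr0 addr0.
set S := frobenius_norm y ^+ 2 / rownorm2 r / T%:R ^+ 2; rewrite expect_bind.
set w := g + c - M%:R * (projection_coef r y / T%:R).
apply: (le_trans (y := expect (col_distr r) (fun j =>
    (normc w ^+ 2 + M%:R * S) +
    (-2) * complex.Re (conjc w * (y 0 j / (A r j * T%:R))) +
    1 * normc (y 0 j / (A r j * T%:R)) ^+ 2))).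
  apply: le_expect; first by case: col_distr_is_distr.
  apply: almostT => j; apply: le_trans (IH _) _.
  set z := y 0 j / _; rewrite (_ : _ - _ = w - z); last by rewrite /w; ring.
  by rewrite normc_sqrB /S; lra.
rewrite (expect_affine _ _ _ _ _ col_distr_is_distr) col_distr_mean.
have := col_distr_second_moment y; rewrite -/S.
set rho := projection_coef r y / T%:R => E2.
rewrite (_ : g + c - _ = w - rho); last by rewrite /w -natr1 -/rho; ring.
rewrite (normc_sqrB w rho) -[M.+1%:R]natr1; have := sqr_ge0 (normc rho).
move: (expect _ _) (normc w ^+ 2) (normc rho ^+ 2) (complex.Re _) E2 => x1 x2 x3 x4.
by clearbody S; lra.
Qed.

(** Pythagoras: with [rho] the projection coefficient and [a] the row, the vector is
    [(y - rho a) + (g + rho) a], an orthogonal sum, and projecting does not lengthen [y]. *)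
Lemma frobenius_sqr_combine (y : 'rV[C]_n) (g : C) :
  frobenius_norm (y + g *: row r A) ^+ 2 <=
  frobenius_norm y ^+ 2 + rownorm2 r * normc (g + projection_coef r y) ^+ 2.
Proof.
set rho := projection_coef r y.
have rhoE : (y *m (row r A)^t*) 0 0 = (rownorm2 r)%:C * rho.
  by rewrite mulrC divfK // gt_eqF // ltcR.
have -> : frobenius_norm (y + g *: row r A) ^+ 2 = frobenius_norm y ^+ 2 +
    2 * complex.Re (conjc g * (y *m (row r A)^t*) 0 0) + normc g ^+ 2 * rownorm2 r.
  have -> : (y *m (row r A)^t*) 0 0 = \sum_j y 0 j * conjc (A r j).
    by rewrite mxE; apply: eq_bigr => j _; rewrite !mxE.
  rewrite !frobenius_row_sqr [conjc g * _]mulr_sumr Re_sum !mulr_sumr -!big_split /=.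
  apply: eq_bigr => j _; rewrite !mxE !normc_sqr.
  by case: g (y 0 j) (A r j) => [? ?] [? ?] [? ?] /=; ring.
rewrite rhoE mulrCA Re_realM.
have -> : normc (g + rho) ^+ 2 =
    normc g ^+ 2 + 2 * complex.Re (conjc g * rho) + normc rho ^+ 2.
  by rewrite !normc_sqr; case: g rho {rhoE} => [? ?] [? ?] /=; ring.
have := mulr_ge0 (ltW r_gt0) (sqr_ge0 (normc rho)); lra.
Qed.

End OneRow.

Lemma iterate_distr_is_distr t l : is_distr (iterate_distr t l).
Proof.
elim: t l => [|t IH] l /=; first exact: is_distr_ret.
apply: is_distr_bind; first exact: row_distr_is_distr.
apply: almost_row_distr => r r_gt0.
by apply: is_distr_bind; [exact: coef_distr_is_distr | exact: almostT].
Qed.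

Lemma combination_rcons l r g :
  combination (rcons l (r, g)) = combination l + g *: row r A.
Proof. by rewrite /combination -cats1 big_cat big_seq1. Qed.

(** Row probabilities cancel the normalisation of the projections, so the mean update is affine in
    [y] with fixed point [z]. The recursion peels off the first step, and the later ones have
    already been moved onto the test vector [u]. *)
Lemma iterate_mean (z : 'rV[C]_n) t l (u : 'cV[C]_n) :
  z *m (A^t* *m A) = b^t* *m A ->
  expect (iterate_distr t l)
    (fun l' => complex.Re (((combination l' - z) *m u) 0 0)) =
  complex.Re (((combination l - z) *m iter t (mulmx (kaczmarz_mean A)) u) 0 0).
Proof.
move=> zE; elim: t l => [|t IH] l /=; first by rewrite expect1.
set v := iter t _ u in IH *; set y := combination l.
rewrite expect_bind.
rewrite (eq_expect (h := fun r => complex.Re (((y - z) *m v) 0 0) +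
    1 * complex.Re ((row r A *m v) 0 0 *
          (conjc (b r 0) / (rownorm2 r)%:C - projection_coef r y)) + 0 * 0)); last first.
  apply: almost_row_distr => r r_gt0; rewrite expect_bind.
  rewrite (eq_expect (h := fun g => complex.Re (((y - z) *m v) 0 0) +
      1 * complex.Re ((row r A *m v) 0 0 * g) + 0 * 0)); last first.
    apply: almostT => g; rewrite IH combination_rcons -/y addrAC mulmxDl -scalemxAl.
    by rewrite !mxE mulr0 addr0 mul1r [g * _]mulrC; case: (\sum_i _) (_ * g) => [? ?] [? ?].
  have cD := coef_distr_is_distr r_gt0 T y (conjc (b r 0) / (rownorm2 r)%:C).
  rewrite (expect_affine _ _ _ _ (fun=> 0) cD) coef_distr_mean //.
  by rewrite mulrCA divff // mulr1 !mul0r.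
rewrite (expect_affine _ _ _ _ (fun=> 0) row_distr_is_distr) mul0r addr0 mul1r.
rewrite expect_enum.
have -> : \sum_r rownorm2 r / F2 * complex.Re ((row r A *m v) 0 0 *
      (conjc (b r 0) / (rownorm2 r)%:C - projection_coef r y)) =
    complex.Re ((F2^-1)%:C * (((b^t* - y *m A^t*) *m (A *m v)) 0 0)).
  rewrite [in RHS]mxE mulr_sumr Re_sum; apply: eq_bigr => r _.
  rewrite -Re_realM; congr complex.Re.
  have -> : (A *m v) r 0 = (row r A *m v) 0 0.
    by rewrite !mxE; apply: eq_bigr => j _; rewrite !mxE.
  have -> : (b^t* - y *m A^t*) 0 r = conjc (b r 0) - (y *m (row r A)^t*) 0 0.
    by rewrite !mxE; congr (_ - _); apply: eq_bigr => j _; rewrite !mxE.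
  (* A zero row is never sampled, and on the other side its residual, even if [b r 0] is nonzero, is
     multiplied by that zero row. *)
  have [r0|r0] := eqVneq (rownorm2 r) 0.
    have /eqP -> : row r A == 0 by rewrite -frobenius_eq0 -sqrf_eq0 r0.
    by rewrite mul0mx !mxE !(mul0r, mulr0).
  have rC : (rownorm2 r)%:C != 0 :> C by rewrite -(rmorph0 (real_complex R)) (inj_eq (@complexI R)).
  have FC : F2%:C != 0 :> C by rewrite gt_eqF // ltcR.
  rewrite (_ : (_ / F2)%:C = (rownorm2 r)%:C / F2%:C); last first.
    by rewrite -fmorphV -rmorphM.
  rewrite (_ : (F2^-1)%:C = (F2%:C)^-1); last exact: fmorphV.
  rewrite /projection_coef; move: (rownorm2 r)%:C F2%:C rC FC => rn fn rC FC.
  by field; rewrite rC FC.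
have -> : (b^t* - y *m A^t*) *m (A *m v) = - ((y - z) *m (A^t* *m A *m v)).
  by rewrite mulmxBl [b^t* *m _]mulmxA -zE -!mulmxA mulmxBl opprB.
have addRe (p q : C) : complex.Re p + complex.Re q = complex.Re (p + q).
  by case: p q => [? ?] [? ?].
rewrite addRe; congr complex.Re; move: (y - z) => e; rewrite /kaczmarz_mean mulmxBl mul1mx mulmxBr.
rewrite -scalemxAl -scalemxAr -!mulmxA.
by move: (e *m v) (e *m _) => p q; rewrite !mxE mulrN.
Qed.

Local Notation beta := (frobenius_norm b / frobenius_norm A).

(** Per step, the noise of [T] inner-product samples costs the factor [1 + 1 / T], and [b] adds the
    average of [|b_r| ^ 2 / |a_r| ^ 2], at most [beta ^ 2]. *)
Lemma iterate_second_moment t l :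
  expect (iterate_distr t l) (fun l' => frobenius_norm (combination l') ^+ 2) <=
  (1 + T%:R^-1) ^+ t * (frobenius_norm (combination l) ^+ 2 + t%:R * beta ^+ 2).
Proof.
have T1 : 0 <= T%:R^-1 :> R by rewrite invr_ge0 ltW.
have beta0 := sqr_ge0 beta.
elim: t l => [|t IH] l /=; first by rewrite expect1 mul0r addr0 mul1r.
set y := combination l; set e := (1 + _) ^+ t in IH.
have e0 : 0 <= e by rewrite exprn_ge0 // addr_ge0.
rewrite expect_bind.
apply: (le_trans (y := expect row_distr (fun r =>
    e * ((1 + T%:R^-1) * frobenius_norm y ^+ 2 + t%:R * beta ^+ 2) +
    e * (normc (b r 0) ^+ 2 / rownorm2 r) + 0 * 0))).
  apply: le_expect; first by case: row_distr_is_distr.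
  apply: almost_row_distr => r r_gt0; rewrite expect_bind.
  set g0 := _ / _.
  have cD := coef_distr_is_distr r_gt0 T y g0.
  apply: (le_trans (y := expect (coef_distr T r y g0) (fun g =>
      e * (frobenius_norm y ^+ 2 + t%:R * beta ^+ 2) +
      (e * rownorm2 r) * normc (g + projection_coef r y) ^+ 2 + 0 * 0))).
    apply: le_expect; first by case: cD.
    apply: almostT => g; apply: le_trans (IH _) _.
    rewrite combination_rcons -/y mulr0 addr0 -mulrA -mulrDr ler_wpM2l //.
    have := frobenius_sqr_combine r_gt0 y g; lra.
  rewrite (expect_affine _ _ _ _ (fun=> 0) cD) mul0r !addr0 mulr0 addr0.
  (* Shifting by the projection coefficient cancels the mean of the [T] samples, leaving [g0] and
     the sampling variance. *)
  have := coef_distr_second_moment r_gt0 T y g0 (projection_coef r y).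
  rewrite mulrCA divff // mulr1 addrK.
  have -> : normc g0 ^+ 2 = normc (b r 0) ^+ 2 / rownorm2 r ^+ 2.
    rewrite /g0 normcM normcV normc_real ger0_norm ?sqr_ge0 // normc_conjc.
    by rewrite exprMn exprVn.
  have r0 : rownorm2 r != 0 by rewrite gt_eqF.
  have T00 : T%:R != 0 :> R by rewrite gt_eqF.
  move=> /(ler_wpM2l (mulr_ge0 e0 (ltW r_gt0))) h.
  rewrite -lerBrDl (le_trans h) // le_eqVlt; apply/orP; left; apply/eqP.
  by move: (rownorm2 r) (beta ^+ 2) r0 => rn bt rn0; field; rewrite T00 rn0.
rewrite (expect_affine _ _ _ _ (fun=> 0) row_distr_is_distr) mul0r addr0.
have sumb : expect row_distr (fun r => normc (b r 0) ^+ 2 / rownorm2 r) <= beta ^+ 2.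
  rewrite expect_enum expr_div_n frobenius_col_sqr mulr_suml; apply: ler_sum => r _.
  have [->|r0] := eqVneq (rownorm2 r) 0; first by rewrite !mul0r divr_ge0 ?sqr_ge0.
  rewrite le_eqVlt; apply/orP; left; apply/eqP.
  by move: (rownorm2 r) r0 => rn rn0; field; rewrite rn0 /= -sqrf_eq0 gt_eqF.
rewrite [(1 + _) ^+ t.+1]exprS -/e [(1 + _) * e]mulrC -mulrA.
rewrite -mulrDr ler_wpM2l // -[t.+1%:R]natr1.
have := mulr_ge0 (mulr_ge0 T1 (ler0n R t)) beta0; have := mulr_ge0 T1 beta0; lra.
Qed.

End RandomizedKaczmarz.

(** * Elementary bounds on the exponential *)

Section Exponentials.
Variable R : realType.

(** [expR x <= 1 / (1 - x)], and [(1 - x) (1 + x + 2 x ^ 2) = 1 + x ^ 2 (1 - 2 x)] is at least 1 on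
    this range. *)
Lemma expR_le_quadratic (x : R) : x <= 1 / 2 -> expR x <= 1 + x + 2 * x ^+ 2.
Proof.
move=> x2; have h := expR_ge1Dx (- x); have x1 : 0 < 1 - x by lra.
rewrite -[leLHS]invrK -expRN.
apply: (le_trans (y := (1 - x)^-1)); first by rewrite lef_pV2 ?posrE ?expR_gt0.
rewrite -div1r ler_pdivrMr //.
have := mulr_ge0 (sqr_ge0 x) (_ : 0 <= 1 - 2 * x); rewrite subr_ge0.
by move=> /(_ ltac:(lra)); nra.
Qed.

Lemma expR1_le4 : expR 1 <= 4 :> R.
Proof.
have h : expR (1 / 2) <= 2 :> R by apply: le_trans (expR_le_quadratic (lexx _)) _; lra.
have -> : (1 : R) = 1 / 2 + 1 / 2 by lra.
by rewrite expRD; have := expR_ge0 (1 / 2 : R); nra.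
Qed.

Lemma compound_le4 T : (0 < T)%N -> (1 + T%:R^-1) ^+ T <= 4 :> R.
Proof.
move=> T0; have T0' : 0 < T%:R :> R by rewrite ltr0n.
apply: le_trans expR1_le4.
have TE : T%:R * T%:R^-1 = 1 :> R by rewrite divff // gt_eqF.
rewrite -[X in expR X]TE expRM_natl ler_pXn2r ?nnegrE ?expR_ge0 ?expR_ge1Dx //.
Qed.

Lemma tilt_le_half (e B : R) : 0 < e -> e <= B -> e / (16 * B ^+ 2) * B <= 1 / 2.
Proof.
move=> e0 eB; have B0 := lt_le_trans e0 eB.
have -> : e / (16 * B ^+ 2) * B = e / (16 * B) by field; rewrite gt_eqF.
by rewrite ler_pdivrMr ?mulr_gt0 //; lra.
Qed.

End Exponentials.

(** * Chernoff bounds for truncated averages *)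

Section Averaging.
Variables (R : realType) (m n : nat).
Local Notation C := R[i].
Local Open Scope complex_scope.
Local Open Scope sesquilinear_scope.
Import Normc.

Variables (A : 'M[C]_(m, n)) (b : 'cV[C]_m) (T : nat) (i : 'I_n) (eps B : R).
Hypotheses (A0 : A != 0) (T0 : (0 < T)%N) (eps0 : 0 < eps) (epsB : eps <= B).

Local Notation beta := (frobenius_norm b / frobenius_norm A).
Local Notation x := ((pseudo_inverse A *m b) i 0).

(** Squared moduli are compared because the machine can form [conj z * z] but no square root.
    Replacing a large value by 0 amounts to skipping an addition. *)
Definition truncate (z : C) : C := if normc z ^+ 2 < B ^+ 2 then z else 0.

Fixpoint sum_distr (N : nat) (acc : C) : seq (R * C) :=
  if N is N'.+1 then
    dbind (iterate_distr A b T T [::])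
      (fun l => sum_distr N' (acc + truncate (combination A l 0 i)))
  else [:: (1, acc)].

Hypothesis bias_le : (\rank A)%:R * beta *
  ((\rank A)%:R * condition_number A ^+ 2) ^+ 2 / T%:R <= eps / 8.
Hypothesis variance_le : 4 * T%:R * beta ^+ 2 / B <= eps / 8.

Let B0 : 0 < B. Proof. exact: lt_le_trans epsB. Qed.
Let itD : is_distr (iterate_distr A b T T [::]).
Proof. exact: iterate_distr_is_distr. Qed.

Lemma combination_nil : combination A [::] = 0.
Proof. exact: big_nil. Qed.

Lemma sample_second_moment :
  expect (iterate_distr A b T T [::])
    (fun l => frobenius_norm (combination A l) ^+ 2) <= 4 * T%:R * beta ^+ 2.
Proof.
apply: le_trans (iterate_second_moment b A0 T0 T [::]) _.
have /eqP -> : frobenius_norm (combination A [::]) == 0.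
  by rewrite combination_nil frobenius_eq0.
rewrite expr0n add0r -mulrA ler_wpM2r ?compound_le4 //.
by rewrite mulr_ge0 // sqr_ge0.
Qed.

(** A discarded value has modulus at least [B], so its modulus is at most [|z| ^ 2 / B]: the second
    moment pays for the truncation. *)
Lemma Re_mul_truncate_le (w z : C) : normc w = 1 ->
  complex.Re (w * truncate z) <= complex.Re (w * z) + normc z ^+ 2 / B.
Proof.
move=> w1; rewrite /truncate; case: ltP => [_|zB].
  by rewrite lerDl divr_ge0 ?sqr_ge0 // ltW.
rewrite mulr0 /=; have := Re_le_normc (- (w * z)).
rewrite normcN normcM w1 mul1r.
have -> : complex.Re (- (w * z)) = - complex.Re (w * z) by case: (w * z).
have zB' : B <= normc z.
  by rewrite -(ler_pXn2r (_ : (0 < 2)%N)) ?nnegrE ?normc_ge0 ?(ltW B0).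
have : normc z <= normc z ^+ 2 / B.
  by rewrite ler_pdivlMr // expr2 ler_wpM2l ?normc_ge0.
lra.
Qed.

Lemma Re_mul_truncate_sqr (w z : C) : normc w = 1 ->
  complex.Re (w * truncate z) ^+ 2 <= B ^+ 2.
Proof.
move=> w1; have tB : normc (w * truncate z) ^+ 2 <= B ^+ 2.
  rewrite normcM w1 mul1r /truncate; case: ltP => [/ltW//|_].
  by rewrite normc0 expr0n sqr_ge0.
by apply: le_trans tB; rewrite normc_sqr lerDl sqr_ge0.
Qed.

(** The allowance [eps / 4] is [eps / 8] for the bias of the iteration plus [eps / 8] for
    truncation; the quadratic term uses that truncated values are bounded by [B]. *)
Lemma sample_exp_moment (w : C) (lam : R) :
  normc w = 1 -> 0 <= lam -> lam * B <= 1 / 2 ->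
  expect (iterate_distr A b T T [::])
    (fun l => expR (lam * complex.Re (w * truncate (combination A l 0 i)))) <=
  expR (lam * (complex.Re (w * conjc x) + eps / 4) + 2 * lam ^+ 2 * B ^+ 2).
Proof.
move=> w1 lam0 lamB; pose z := (pseudo_inverse A *m b)^t*.
pose u : 'cV[C]_n := w *: delta_mx i 0.
have zi : z 0 i = conjc x by rewrite !mxE.
have uE (y : 'rV[C]_n) : (y *m u) 0 0 = w * y 0 i.
  by rewrite /u -scalemxAr mxE -colE mxE.
have u1 : frobenius_norm u <= 1.
  rewrite -(ler_pXn2r (_ : (0 < 2)%N)) ?nnegrE ?frobenius_ge0 // expr1n.
  rewrite frobenius_col_sqr (bigD1 i) //= big1 ?addr0 => [|j ji].
    by rewrite !mxE !eqxx mulr1 w1 expr1n.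
  by rewrite !mxE (negPf ji) mulr0 normc0 expr0n.
have [k [s [U [V AUV]]]] := svd_exists A.
have mean := iterate_mean A0 T0 T [::] u (normal_equation AUV b).
have bias := le_trans (kaczmarz_bias b A0 T0 u1) bias_le.
set Rx := complex.Re (w * conjc x).
apply: (le_trans (y := expect (iterate_distr A b T T [::]) (fun l =>
    (1 + lam * Rx + 2 * lam ^+ 2 * B ^+ 2) +
    lam * complex.Re (((combination A l - z) *m u) 0 0) +
    (lam / B) * frobenius_norm (combination A l) ^+ 2))).
  apply: le_expect; first by case: itD.
  apply: almostT => l; set X := combination A l 0 i; set D := complex.Re _.
  have D2 : D ^+ 2 <= B ^+ 2 by apply: Re_mul_truncate_sqr.
  have DB : D <= B.
    apply: le_trans (ler_norm _) _.
    by rewrite -(ler_pXn2r (_ : (0 < 2)%N)) ?nnegrE ?(ltW B0) // real_normK ?num_real.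
  have lD : lam * D <= 1 / 2 by apply: le_trans lamB; rewrite ler_wpM2l.
  apply: le_trans (expR_le_quadratic lD) _.
  have DX : D <= complex.Re (w * X) + frobenius_norm (combination A l) ^+ 2 / B.
    apply: le_trans (Re_mul_truncate_le X w1) _; rewrite lerD2l ler_pM2r ?invr_gt0 //.
    by rewrite ler_pXn2r ?nnegrE ?normc_ge0 ?frobenius_ge0 // normc_le_frobenius.
  have -> : complex.Re (((combination A l - z) *m u) 0 0) = complex.Re (w * X) - Rx.
    by rewrite uE mxE [X in w * (_ + X)]mxE zi mulrBr ReB.
  have := ler_wpM2l lam0 DX; have := ler_wpM2l (sqr_ge0 lam) D2.
  rewrite exprMn mulrDr [lam / B * _]mulrAC -[lam * _ / B]mulrA; lra.
rewrite (expect_affine _ _ _ _ _ itD) mean.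
apply: le_trans (expR_ge1Dx _); rewrite -!addrA lerD2l.
rewrite combination_nil sub0r mulNmx.
set G := iter T _ u in bias *.
have Gle : complex.Re ((- (z *m G)) 0 0) <= eps / 8.
  by rewrite mxE (le_trans (Re_le_normc _)) // normcN.
have Vle : lam / B * expect (iterate_distr A b T T [::])
    (fun l => frobenius_norm (combination A l) ^+ 2) <= lam * (eps / 8).
  rewrite -mulrA ler_wpM2l // mulrC (le_trans _ variance_le) //.
  by rewrite ler_pM2r ?invr_gt0 // sample_second_moment.
by have := ler_wpM2l lam0 Gle; lra.
Qed.

Lemma sum_distr_is_distr N acc : is_distr (sum_distr N acc).
Proof.
elim: N acc => [|N IH] acc /=; first exact: is_distr_ret.
by apply: is_distr_bind => //; apply: almostT.
Qed.

Lemma sum_exp_moment (w : C) (lam q : R) N acc :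
  expect (iterate_distr A b T T [::])
    (fun l => expR (lam * complex.Re (w * truncate (combination A l 0 i)))) <= expR q ->
  expect (sum_distr N acc) (fun S => expR (lam * complex.Re (w * S))) <=
  expR (lam * complex.Re (w * acc) + N%:R * q).
Proof.
move=> one; elim: N acc => [|N IH] acc /=; first by rewrite expect1 mul0r addr0.
rewrite expect_bind.
apply: (le_trans (y := expect (iterate_distr A b T T [::]) (fun l =>
    expR (lam * complex.Re (w * acc) + N%:R * q) *
    expR (lam * complex.Re (w * truncate (combination A l 0 i)))))).
  apply: le_expect; first by case: itD.
  apply: almostT => l; apply: le_trans (IH _) _; rewrite -expRD ler_expR mulrDr.
  rewrite le_eqVlt; apply/orP; left; apply/eqP.
  by case: (w * acc) (w * truncate _) => [? ?] [? ?] /=; ring.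
rewrite expectZ -[N.+1%:R]natr1 mulrDl mul1r addrA [leRHS]expRD ler_wpM2l ?expR_ge0 //.
Qed.

Lemma expect_sum (X : Type) (mu : seq (R * X)) (I : Type) (r : seq I) (g : I -> X -> R) :
  expect mu (fun y => \sum_(j <- r) g j y) = \sum_(j <- r) expect mu (g j).
Proof.
by rewrite /expect exchange_big; apply: eq_bigr => w _; rewrite mulr_sumr.
Qed.

Definition directions : seq C := [:: 1; -1; 'i; - 'i].

(** Real and imaginary parts are at most [eps / 2] in absolute value. Only one-sided tail bounds are
    then required, at the price of a union over four directions. *)
Lemma normc_le_directions (z : C) :
  (forall w, w \in directions -> complex.Re (w * z) <= eps / 2) -> normc z <= eps.
Proof.
move=> h; rewrite -(ler_pXn2r (_ : (0 < 2)%N)) ?nnegrE ?normc_ge0 ?(ltW eps0) //.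
have h1 := h 1; have h2 := h (-1); have h3 := h 'i; have h4 := h (- 'i).
move: h1 h2 h3 h4; rewrite !inE !eqxx ?orbT /= normc_sqr.
case: z {h} => a c /=.
rewrite !(mul0r, mul1r, mulN1r, mulNr, oppr0, sub0r, subr0, add0r, opprK, mulr0, addr0).
move=> /(_ isT) h1 /(_ isT) h2 /(_ isT) h3 /(_ isT) h4.
have a2 : a ^+ 2 <= (eps / 2) ^+ 2 by nra.
have c2 : c ^+ 2 <= (eps / 2) ^+ 2 by nra.
by have := sqr_ge0 eps; lra.
Qed.

Lemma normc_directions w : w \in directions -> normc w = 1.
Proof.
rewrite !inE => /or4P[]/eqP ->; rewrite ?normcN ?normc1 //=;
  by rewrite expr0n add0r expr1n sqrtr1.
Qed.

Lemma average_concentration N : (0 < N)%N ->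
  1 - 4 * expR (- (N%:R * (eps ^+ 2 / (128 * B ^+ 2)))) <=
  expect (sum_distr N 0) (fun S => (normc (conjc (S / N%:R) - x) <= eps)%R%:R).
Proof.
move=> N0; have N0' : 0 < N%:R :> R by rewrite ltr0n.
(* Minimiser of [- lam * eps / 4 + 2 * lam ^ 2 * B ^ 2], the exponent per sample; the minimum is
   [- eps ^ 2 / (128 * B ^ 2)]. *)
pose lam := eps / (16 * B ^+ 2).
have lam0 : 0 < lam by rewrite divr_gt0 // mulr_gt0 // exprn_gt0.
have lamB : lam * B <= 1 / 2 by apply: tilt_le_half.
pose kap w := lam * (N%:R * (complex.Re (w * conjc x) + eps / 2)).
pose g w S := expR (- kap w) * expR (lam * complex.Re (w * S)).
(* Markov and union bound at once: the nonnegative [g w S] are such that on failure at least one of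
   them is at least 1. *)
apply: (le_trans (y := expect (sum_distr N 0) (fun S =>
    1 + (-1) * (\sum_(w <- directions) g w S) + 0 * 0))); last first.
  apply: le_expect; first by case: (sum_distr_is_distr N 0).
  apply: almostT => S; rewrite mulr0 addr0 mulN1r.
  have g0 w : 0 <= g w S by rewrite mulr_ge0 ?expR_ge0.
  case: (lerP (normc _) eps) => [_|bad]; first by rewrite lerBlDr lerDl sumr_ge0.
  have [w wd wbad] : exists2 w, w \in directions &
      eps / 2 < complex.Re (w * (S / N%:R - conjc x)).
    apply: contrapT => none; move: bad; rewrite ltNge => /negP; apply.
    have -> : conjc (S / N%:R) - x = conjc (S / N%:R - conjc x).
      by case: (S / N%:R) (x) => [? ?] [? ?]; rewrite /conjc; simpc.
    rewrite normc_conjc; apply: normc_le_directions => w wd.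
    by rewrite leNgt; apply/negP => lt; apply: none; exists w.
  rewrite subr_le0 (big_rem w wd) /=.
  apply: (le_trans (y := g w S)); last by rewrite lerDl sumr_ge0.
  rewrite /g -expRD -[leLHS]expR0 ler_expR /kap -mulrN -mulrDr mulr_ge0 ?(ltW lam0) //.
  have NS : N%:R * complex.Re (w * (S / N%:R - conjc x)) =
      complex.Re (w * S) - N%:R * complex.Re (w * conjc x).
    have -> : w * (S / N%:R - conjc x) = (N%:R^-1)%:C * (w * S) - w * conjc x.
      by rewrite fmorphV rmorph_nat; ring.
    by rewrite ReB Re_realM mulrBr mulVKf // gt_eqF.
  have := mulr_gt0 N0' (_ : 0 < complex.Re (w * (S / N%:R - conjc x)) - eps / 2).
  rewrite subr_gt0 => /(_ wbad); rewrite mulrBr NS; lra.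
rewrite (expect_affine _ _ _ _ (fun=> 0) (sum_distr_is_distr N 0)) mul0r addr0.
rewrite mulN1r lerD2l lerN2 expect_sum.
set e := expR _.
have -> : 4 * e = \sum_(w <- directions) e by rewrite !big_cons big_nil; lra.
rewrite big_seq [leRHS]big_seq; apply: ler_sum => w /normc_directions w1.
rewrite expectZ; have := sum_exp_moment N 0 (sample_exp_moment w1 (ltW lam0) lamB).
rewrite mulr0 /= mulr0 add0r => /(ler_wpM2l (expR_ge0 (- kap w))) h.
apply: le_trans h _; rewrite -expRD ler_expR /kap.
rewrite le_eqVlt; apply/orP; left; apply/eqP.
by rewrite /lam; field; rewrite gt_eqF.
Qed.

End Averaging.

(** * The program *)

Fixpoint block (P : program) (Ps : seq program) : program :=
  if Ps is Q :: Qs then Seq P (block Q Qs) else P.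

(* The coefficient and row-index arrays of the current iterate start at this address
   in the value and index memories; all smaller addresses are registers. *)
Definition base : nat := 20.

(* vmem[5] := entry imem[5] of the current iterate, whose arrays end at imem[7]. *)
Definition entry_loop : program :=
  While (TIndexLt 6 7)
    (block (Instr (ILoad 13 6))
       [:: Instr (VLoad 14 6); Instr (QueryA 15 13 5); Instr (VArith Mul 14 14 15);
           Instr (VArith Add 5 5 14); Instr (IAdd 6 6 12)]).

Definition entry : program :=
  block (Instr (IConst 6 base))
    [:: Instr (IConst 13 0); Instr (VOfIndex 5 13); entry_loop].

(* vmem[7] -= vmem[5] / (A(imem[4], imem[5]) * vmem[10]), once for each sample. *)
Definition coef_loop : program :=
  While (TIndexLt 8 9)
    (block (Instr (SampleCol 5 4))
       [:: entry; Instr (QueryA 6 4 5); Instr (VArith Mul 6 6 10);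
           Instr (VArith Div 5 5 6); Instr (VArith Defs.Sub 7 7 5); Instr (IAdd 8 8 12)]).

Definition iterate_loop : program :=
  While (TIndexLt 7 9)
    (block (Instr (SampleRow 4))
       [:: Instr (QueryB 7 4); Instr (VConj 7 7); Instr (QueryRowNorm 6 4);
           Instr (VArith Mul 6 6 6); Instr (VArith Div 7 7 6); Instr (IConst 8 base);
           coef_loop; Instr (IStore 7 4); Instr (VStore 7 7); Instr (IAdd 7 7 12)]).

(* vmem[8] accumulates the truncated samples of the entry imem[3]. *)
Definition sum_loop : program :=
  While (TIndexLt 11 10)
    (block (Instr (IConst 7 base))
       [:: iterate_loop; Instr (IAdd 5 3 15); entry; Instr (VConj 6 5);
           Instr (VArith Mul 6 6 5);
           If (TValueLt 6 3) (Instr (VArith Add 8 8 5)) (Instr (IConst 13 0));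
           Instr (IAdd 11 11 12)]).

(** Rounding up by counting: [d] counts in the index memory while [c] runs through values that can
    be compared with a real threshold. *)
Definition counting_loop (t : test) (d e : nat) (o : arith) (c w : nat) : program :=
  While t (Seq (Instr (IAdd d d e)) (Instr (VArith o c c w))).

(* imem[9] := base + T and vmem[10] := T, where T is the least integer that is at
   least 1 + 8 k beta K^2 / eps, with beta = ||b|| / ||A||_F and K = k kappa^2. *)
Definition setup_iterations (P : program) : program :=
  block (Instr (IConst 12 1))
    [:: Instr (IConst 15 0); Instr (QueryFrobenius 3); Instr (QueryNormB 4);
        Instr (VArith Div 4 4 3); Instr (VOfIndex 5 2); Instr (VArith Mul 6 0 0);
        Instr (VArith Mul 6 5 6); Instr (VArith Mul 6 6 6); Instr (VArith Mul 5 5 4);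
        Instr (VArith Mul 6 5 6); Instr (IConst 13 8); Instr (VOfIndex 7 13);
        Instr (VArith Mul 6 7 6); Instr (VArith Div 6 6 1); Instr (VOfIndex 9 12);
        Instr (VArith Add 6 9 6); Instr (IConst 9 base); Instr (VOfIndex 10 15);
        counting_loop (TValueLt 10 6) 9 12 Add 10 9; P].

(* vmem[3] := B^2 for the truncation level B = 32 T beta^2 / eps + eps, and
   imem[14] := N, the least integer that is at least 384 (B / eps)^2. *)
Definition setup_batch (P : program) : program :=
  block (Instr (IConst 13 32))
    [:: Instr (VOfIndex 7 13); Instr (VArith Mul 7 7 10); Instr (VArith Mul 4 4 4);
        Instr (VArith Mul 7 7 4); Instr (VArith Div 7 7 1); Instr (VArith Add 7 7 1);
        Instr (VArith Mul 3 7 7); Instr (VArith Div 6 7 1); Instr (VArith Mul 6 6 6);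
        Instr (IConst 13 384); Instr (VOfIndex 11 13); Instr (VArith Mul 6 11 6);
        Instr (IConst 14 0); Instr (VOfIndex 11 15);
        counting_loop (TValueLt 11 6) 14 12 Add 11 9; P].

(* imem[10] := N L, where L is the least integer with 2^-L <= delta. *)
Definition setup_total (P : program) : program :=
  block (Instr (IConst 10 0))
    [:: Instr (VOfIndex 11 12); Instr (IConst 13 2); Instr (VOfIndex 12 13);
        counting_loop (TValueLt 2 11) 10 14 Div 11 12; P].

(** Relies on the layout of [init_mem]: [k] and [i] in [imem] 2 and 3; [kappa], [eps], [delta] in
    [vmem] 0 to 2. The last conjugation undoes that of the row-vector iterates. *)
Definition solver : program :=
  setup_iterations (setup_batch (setup_total
    (block (Instr (VOfIndex 8 15))
       [:: Instr (IConst 11 0); sum_loop; Instr (VOfIndex 6 10);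
           Instr (VArith Div 8 8 6); Instr (VConj 0 8)]))).

Ltac run_instr := eapply wp_instr; [reflexivity | simpl].

(** * Registers left unchanged *)

Section Frames.
Variable R : realType.
Local Notation memory := (memory R).
Local Notation set_val := (@Defs.set_val R).

Definition frame (p q : pred nat) (s s' : memory) : Prop :=
  (forall a, ~~ p a -> imem s' a = imem s a) /\
  (forall a, ~~ q a -> vmem s' a = vmem s a).

Lemma frame_refl p q s : frame p q s s.
Proof. by []. Qed.

Lemma frame_set_idx (p q : pred nat) s s' d v :
  p d -> frame p q s s' -> frame p q s (set_idx s' d v).
Proof.
move=> pd [fi fv]; split=> // a pa /=; case: eqP => [E|_]; last exact: fi.
by move: pa; rewrite E pd.
Qed.

Lemma frame_set_val (p q : pred nat) s s' d v :
  q d -> frame p q s s' -> frame p q s (set_val s' d v).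
Proof.
move=> qd [fi fv]; split=> // a qa /=; case: eqP => [E|_]; last exact: fv.
by move: qa; rewrite E qd.
Qed.

Lemma frame_trans (p q p' q' : pred nat) s s' s'' :
  subpred p' p -> subpred q' q ->
  frame p q s s' -> frame p' q' s' s'' -> frame p q s s''.
Proof.
move=> pp qq [fi fv] [fi' fv']; split=> a na.
  by rewrite fi' ?fi //; apply: contra na; apply: pp.
by rewrite fv' ?fv //; apply: contra na; apply: qq.
Qed.

End Frames.

(** * Correctness and running time of the loops *)

Section ProgramCorrectness.
Variables (R : realType) (m n : nat).
Local Notation C := R[i].
Local Open Scope complex_scope.
Import Normc.
Local Notation memory := (memory R).
Local Notation set_val := (@Defs.set_val R).

Variables (A : 'M[C]_(m, n)) (b : 'cV[C]_m) (f : memory -> R).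
Local Notation wp := (wp A b f).
Local Notation exec := (exec A b).

Lemma exec_queryA d p q (s : memory) (r : 'I_m) (j : 'I_n) :
  imem s p = r -> imem s q = j ->
  exec (QueryA d p q) s = [:: (1, set_val s d (A r j))].
Proof. by rewrite /Defs.exec => -> ->; rewrite !valK. Qed.

Lemma exec_queryB d p (s : memory) (r : 'I_m) :
  imem s p = r -> exec (QueryB d p) s = [:: (1, set_val s d (b r 0))].
Proof. by rewrite /Defs.exec => ->; rewrite valK. Qed.

Lemma exec_queryRowNorm d p (s : memory) (r : 'I_m) :
  imem s p = r ->
  exec (QueryRowNorm d p) s = [:: (1, set_val s d (frobenius_norm (row r A))%:C)].
Proof. by rewrite /Defs.exec => ->; rewrite valK. Qed.

Lemma wp_sampleRow T d K s g :
  A != 0 ->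
  (forall r : 'I_m, 0 < frobenius_norm (row r A) ^+ 2 ->
     wp T K (set_idx s d r) (g r)) ->
  wp T.+1 (Instr (SampleRow d) :: K) s (expect (row_distr A) g).
Proof.
move=> A0 h; apply: (@wp_sample _ _ _ _ _ _ _ _ (fun r => set_idx s d (nat_of_ord r))).
- by rewrite /= /row_distr -[RHS]map_comp.
- by have [] := row_distr_is_distr A0.
- exact: almost_row_distr.
Qed.

Lemma wp_sampleCol T d p K s g (r : 'I_m) :
  imem s p = r -> 0 < frobenius_norm (row r A) ^+ 2 ->
  (forall j : 'I_n, wp T K (set_idx s d j) (g j)) ->
  wp T.+1 (Instr (SampleCol d p) :: K) s (expect (col_distr A r) g).
Proof.
move=> E r0 h; apply: (@wp_sample _ _ _ _ _ _ _ _ (fun j => set_idx s d (nat_of_ord j))).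
- by rewrite /= E valK /col_distr -[RHS]map_comp.
- by have [] := col_distr_is_distr r0.
- exact: almostT.
Qed.

(** [phi l] is the content of [c] after [l] rounds and [j] the rounds already done, so counting up
    and repeated halving are both covered. *)
Lemma wp_counting_loop (phi : nat -> C) N t d e o c w T K s v j :
  d != e -> c != w -> (j <= N)%N -> vmem s c = phi j ->
  (forall l, (l < N)%N -> phi l.+1 = eval_arith o (phi l) (vmem s w)) ->
  (forall l s', (l <= N)%N -> frame (pred1 d) (pred1 c) s s' -> vmem s' c = phi l ->
     eval_test t s' = (l < N)%N) ->
  (forall s', frame (pred1 d) (pred1 c) s s' -> vmem s' c = phi N ->
     imem s' d = (imem s d + (N - j) * imem s e)%N -> wp T K s' v) ->
  wp (T + 4 * (N - j) + 1) (counting_loop t d e o c w :: K) s v.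
Proof.
move=> de cw jN; move Ek: (N - j)%N => k.
elim: k j s jN Ek => [|k IH] j s jN Ek sc phiS tE post.
  have jE : j = N by lia.
  rewrite muln0 addn0 addn1; apply: wp_while_end.
    by rewrite (tE j) ?jE ?ltnn // -?jE.
  by apply: post; rewrite // ?mul0n ?addn0 // sc jE.
have jN' : (j < N)%N by lia.
(* A round takes four steps: the test, the [Seq] and two instructions. Here and below each [wp] rule
   consumes one successor. *)
apply: (@wp_time _ _ _ _ _ _ (T + 4 * k + 1).+4); first by lia.
apply: wp_while; first by rewrite (tE j).
apply: wp_seq; run_instr; run_instr.
set s1 := Defs.set_val _ _ _.
have fr1 : frame (pred1 d) (pred1 c) s s1.
  by apply: frame_set_val => /=; rewrite ?eqxx //; apply: frame_set_idx => /=; rewrite ?eqxx.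
have s1w : vmem s1 w = vmem s w by apply: fr1.2 => /=; rewrite eq_sym.
have s1e : imem s1 e = imem s e by apply: fr1.1 => /=; rewrite eq_sym.
apply: (IH j.+1) => //; first by lia.
- by rewrite /= eqxx sc phiS.
- by move=> l lN; rewrite s1w phiS.
- by move=> l s' lN fr; apply: tE => //; apply: frame_trans fr1 fr.
move=> s' fr E1 E2; apply: post => //; first exact: frame_trans fr1 fr.
by rewrite E2 s1e /= eqxx; lia.
Qed.

Definition regs (l : seq nat) : pred nat := fun a => a \in l.
Definition regs_arrays (l : seq nat) : pred nat := fun a => (base <= a)%N || (a \in l).

(** Positions are described by splittings of the list, since [nth] would require a default element
    of ['I_m * C]. *)
Definition stored (l : seq ('I_m * C)) (s : memory) : Prop :=
  forall l1 x l2, l = l1 ++ x :: l2 ->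
    imem s (base + size l1)%N = x.1 /\ vmem s (base + size l1)%N = x.2.

Lemma stored_frame (p q : pred nat) l s s' :
  (forall a, (base <= a)%N -> ~~ p a && ~~ q a) ->
  frame p q s s' -> stored l s -> stored l s'.
Proof.
move=> pq [fi fv] st l1 x l2 /st[E1 E2].
by have /andP[np nq] := pq (base + size l1)%N (leq_addr _ _); rewrite fi ?fv.
Qed.

Lemma subpred_regs l (q : pred nat) : all q l -> subpred (regs l) q.
Proof. by move=> /allP ql a /ql. Qed.

Lemma subpred_regs_arrays l l' :
  all (fun a => a \in l') l -> subpred (regs_arrays l) (regs_arrays l').
Proof. by move=> /allP ll a /orP[h|/ll h]; rewrite /regs_arrays ?h ?orbT. Qed.

Lemma wp_entry_loop l1 l2 (c : 'I_n) T K s v :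
  imem s 12 = 1%N -> imem s 5 = c -> imem s 6 = (base + size l1)%N ->
  imem s 7 = (base + size (l1 ++ l2))%N -> stored (l1 ++ l2) s ->
  vmem s 5 = combination A l1 0 c ->
  (forall s', frame (regs [:: 6; 13]) (regs [:: 5; 14; 15]) s s' ->
     vmem s' 5 = combination A (l1 ++ l2) 0 c -> wp T K s' v) ->
  wp (T + 12 * size l2 + 1) (entry_loop :: K) s v.
Proof.
elim: l2 l1 s => [|x l2 IH] l1 s s12 s5 s6 s7 st v5 post.
  rewrite muln0 addn0 addn1; apply: wp_while_end; last by apply: post; rewrite ?cats0.
  by rewrite /= s6 s7 cats0 ltnn.
have [r6 w6] := st l1 x l2 erefl.
apply: (@wp_time _ _ _ _ _ _ (T + 12 * size l2 + 1 + 12)) => /=; first by lia.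
rewrite [(_ + 12)%N]addnC; apply: wp_while.
  by rewrite /= s6 s7 size_cat /= addnS -addnS leq_add2l; lia.
apply: wp_seq; run_instr; apply: wp_seq; run_instr; rewrite s6 r6 w6; apply: wp_seq.
eapply wp_instr; first by apply: (@exec_queryA _ _ _ _ x.1 c).
apply: wp_seq; run_instr; apply: wp_seq; run_instr; run_instr; rewrite s6 s12.
set s1 := set_idx _ _ _.
have fr1 : frame (regs [:: 6; 13]) (regs [:: 5; 14; 15]) s s1.
  by do ?[apply: frame_set_idx => // | apply: frame_set_val => //].
apply: (IH (rcons l1 x)); rewrite ?cat_rcons.
- by rewrite fr1.1.
- by rewrite fr1.1.
- by rewrite /= size_rcons addn1 addnS.
- by rewrite fr1.1.
- apply: stored_frame fr1 st => a; rewrite /regs !inE /base; lia.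
- rewrite /= v5 /combination -cats1 big_cat big_seq1 /=.
  by rewrite !mxE.
move=> s' fr E; apply: post; last by rewrite E.
by apply: frame_trans fr1 fr.
Qed.

Lemma wp_entry l (c : 'I_n) T K s v :
  imem s 12 = 1%N -> imem s 5 = c -> imem s 7 = (base + size l)%N -> stored l s ->
  (forall s', frame (regs [:: 6; 13]) (regs [:: 5; 14; 15]) s s' ->
     vmem s' 5 = combination A l 0 c -> wp T K s' v) ->
  wp (T + 12 * size l + 7) (entry :: K) s v.
Proof.
move=> s12 s5 s7 st post.
apply: (@wp_time _ _ _ _ _ _ (T + 12 * size l + 1).+4.+2); first by lia.
apply: wp_seq; run_instr; apply: wp_seq; run_instr; apply: wp_seq; run_instr.
set s1 := Defs.set_val _ _ _.
have fr1 : frame (regs [:: 6; 13]) (regs [:: 5; 14; 15]) s s1.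
  by do ?[apply: frame_set_idx => // | apply: frame_set_val => //].
apply: (@wp_entry_loop [::] l c) => //; rewrite ?fr1.1 //.
  by rewrite /= combination_nil mxE.
by move=> s' fr E; apply: post => //; apply: frame_trans fr1 fr.
Qed.

Lemma wp_coef_loop T M l (r : 'I_m) g Tm K s h :
  0 < frobenius_norm (row r A) ^+ 2 -> (M <= T)%N ->
  imem s 12 = 1%N -> imem s 4 = r -> imem s 9 = (base + T)%N ->
  imem s 7 = (base + size l)%N -> imem s 8 = (base + (T - M))%N -> stored l s ->
  vmem s 10 = T%:R -> vmem s 7 = g ->
  (forall s' g', frame (regs [:: 5; 6; 8; 13]) (regs [:: 5; 6; 7; 14; 15]) s s' ->
     vmem s' 7 = g' -> wp Tm K s' (h g')) ->
  wp (Tm + M * (12 * size l + 30) + 1) (coef_loop :: K) s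
    (expect (coef_distr A T M r (combination A l) g) h).
Proof.
move=> r0; elim: M g s => [|M IH] g s MT s12 s4 s9 s7 s8 st v10 v7 post.
  rewrite addn0 addn1 expect1; apply: wp_while_end; last exact: post.
  by rewrite /= s8 s9 subn0 ltnn.
apply: (@wp_time _ _ _ _ _ _
  ((((Tm + M * (12 * size l + 30) + 1).+4.+4.+1) + 12 * size l + 7).+4)); first by lia.
rewrite /= expect_bind; apply: wp_while; first by rewrite /= s8 s9; lia.
apply: wp_seq; apply: (wp_sampleCol (r := r)) => // j; apply: wp_seq.
set s1 := set_idx _ _ _.
have fr1 : frame (regs [:: 5; 6; 8; 13]) (regs [:: 5; 6; 7; 14; 15]) s s1.
  by apply: frame_set_idx.
apply: (@wp_entry l j _ _ s1 _ s12 erefl s7 st) => s2 fr2 v5.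
have s25 : imem s2 5 = j by rewrite fr2.1.
have s28 : imem s2 8 = (base + (T - M.+1))%N by rewrite fr2.1.
have v27 : vmem s2 7 = g by rewrite fr2.2.
have {}fr2 : frame (regs [:: 5; 6; 8; 13]) (regs [:: 5; 6; 7; 14; 15]) s s2.
  by apply: frame_trans fr1 fr2; apply: subpred_regs.
apply: wp_seq; eapply wp_instr.
  by apply: (@exec_queryA _ _ _ _ r j) => //; rewrite fr2.1.
apply: wp_seq; run_instr; apply: wp_seq; run_instr; apply: wp_seq; run_instr; run_instr.
rewrite v5 v27 s28 [imem s2 12]fr2.1 // [vmem s2 10]fr2.2 // v10 s12.
set s3 := set_idx _ _ _.
have fr3 : frame (regs [:: 5; 6; 8; 13]) (regs [:: 5; 6; 7; 14; 15]) s s3.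
  by do ?[apply: frame_set_idx => // | apply: frame_set_val => //].
apply: IH; try first [exact: ltnW | by rewrite fr3.1 | by rewrite fr3.2 | by []].
- by rewrite /=; lia.
- apply: stored_frame fr3 st => a; rewrite /regs !inE /base; lia.
by move=> s' g' fr; apply: post; apply: frame_trans fr3 fr.
Qed.

Lemma stored_rcons l (r : 'I_m) g s :
  stored l s -> imem s (base + size l) = r -> vmem s (base + size l) = g ->
  stored (rcons l (r, g)) s.
Proof.
move=> st E1 E2 l1 x; case/lastP => [|l2 y].
  by rewrite cats1 => /eqP; rewrite eqseq_rcons => /andP[/eqP <- /eqP <-].
rewrite -rcons_cons -rcons_cat => /eqP; rewrite eqseq_rcons => /andP[/eqP E _].
exact: st E.
Qed.

Lemma wp_iterate_loop T t l Tm K s h :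
  A != 0 -> (size l + t = T)%N ->
  imem s 12 = 1%N -> imem s 9 = (base + T)%N ->
  imem s 7 = (base + size l)%N -> stored l s -> vmem s 10 = T%:R ->
  (forall s' l',
     frame (regs_arrays [:: 4; 5; 6; 7; 8; 13]) (regs_arrays [:: 5; 6; 7; 14; 15]) s s' ->
     stored l' s' -> imem s' 7 = (base + size l')%N -> size l' = T ->
     wp Tm K s' (h l')) ->
  wp (Tm + t * (T * (12 * T + 30) + 30) + 1) (iterate_loop :: K) s
    (expect (iterate_distr A b T t l) h).
Proof.
move=> A0; elim: t l s => [|t IH] l s lT s12 s9 s7 st v10 post.
  rewrite addn0 addn1 expect1; apply: wp_while_end.
    by rewrite /= s7 s9 -lT addn0 ltnn.
  by apply: post => //; rewrite -lT addn0.
apply: (@wp_time _ _ _ _ _ _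
  ((((Tm + t * (T * (12 * T + 30) + 30) + 1).+4.+2) + T * (12 * size l + 30) + 1).+4.+4.+4.+4)).
  have : (T * (12 * size l + 30) <= T * (12 * T + 30))%N by rewrite leq_mul2l; lia.
  by lia.
rewrite /= expect_bind; apply: wp_while; first by rewrite /= s7 s9; lia.
apply: wp_seq; apply: wp_sampleRow => // r r0; rewrite expect_bind.
apply: wp_seq; eapply wp_instr; first by apply: (@exec_queryB _ _ _ r).
apply: wp_seq; run_instr.
apply: wp_seq; eapply wp_instr; first by apply: (@exec_queryRowNorm _ _ _ r).
apply: wp_seq; run_instr; apply: wp_seq; run_instr; apply: wp_seq; run_instr.
apply: wp_seq; set s1 := set_idx _ _ _.
have fr1 : frame (regs_arrays [:: 4; 5; 6; 7; 8; 13])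
    (regs_arrays [:: 5; 6; 7; 14; 15]) s s1.
  by do ?[apply: frame_set_idx => // | apply: frame_set_val => //].
apply: (@wp_time _ _ _ _ _ _
  (((Tm + t * (T * (12 * T + 30) + 30) + 1).+4.+1) + T * (12 * size l + 30) + 1)).
  by lia.
apply: (@wp_coef_loop T T l r) => //.
- by rewrite /= subnn addn0.
- by rewrite /= -expr2 -rmorphXn.
move=> s2 g' fr2 v7.
have s27 : imem s2 7 = (base + size l)%N by rewrite fr2.1.
have s24 : imem s2 4 = r by rewrite fr2.1.
have {}st2 : stored l s2.
  by apply: stored_frame fr2 (_ : stored l s1) => // a; rewrite /regs !inE /base; lia.
have {}fr2 : frame (regs_arrays [:: 4; 5; 6; 7; 8; 13])
    (regs_arrays [:: 5; 6; 7; 14; 15]) s s2.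
  by apply: frame_trans fr1 fr2; apply: subpred_regs.
apply: wp_seq; run_instr; apply: wp_seq; run_instr; run_instr; rewrite s27 s24 v7.
set s3 := set_idx _ 7 _.
have fr3 : frame (regs_arrays [:: 4; 5; 6; 7; 8; 13])
    (regs_arrays [:: 5; 6; 7; 14; 15]) s s3.
  by do ?[apply: frame_set_idx => // | apply: frame_set_val => //].
have s37 : imem s3 7 = (base + size (rcons l (r, g')))%N.
  by rewrite /= fr2.1 // s12 size_rcons addn1 addnS.
apply: (IH (rcons l (r, g'))) => //.
- by rewrite size_rcons -lT addSnnS.
- by rewrite fr3.1.
- by rewrite fr3.1.
- apply: stored_rcons; rewrite /= ?eqxx //.
  move=> l1 x l2 E; have [E1 E2] := st2 l1 x l2 E.
  have ne : ((base + size l1)%N == (base + size l)%N) = false.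
    by rewrite E size_cat /=; apply/eqP; lia.
  by rewrite /= ne.
- by rewrite fr3.2.
by move=> s' l' fr; apply: post; apply: frame_trans fr3 fr.
Qed.

Lemma wp_sum_loop T (i : 'I_n) B N0 N acc Tm K s h :
  A != 0 -> (N <= N0)%N ->
  imem s 3 = i -> imem s 9 = (base + T)%N -> imem s 10 = N0 ->
  imem s 11 = (N0 - N)%N -> imem s 12 = 1%N -> imem s 15 = 0%N ->
  vmem s 3 = (B ^+ 2)%:C -> vmem s 8 = acc -> vmem s 10 = T%:R ->
  (forall s' S,
     frame (regs_arrays [:: 4; 5; 6; 7; 8; 11; 13])
       (regs_arrays [:: 5; 6; 7; 8; 14; 15]) s s' ->
     vmem s' 8 = S -> wp Tm K s' (h S)) ->
  wp (Tm + N * (T * (T * (12 * T + 30) + 30) + 12 * T + 30) + 1) (sum_loop :: K) s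
    (expect (sum_distr A b T i B N acc) h).
Proof.
move=> A0; elim: N acc s => [|N IH] acc s NN s3 s9 s10 s11 s12 s15 v3 v8 v10 post.
  rewrite addn0 addn1 expect1; apply: wp_while_end; last exact: post.
  by rewrite /= s10 s11 subn0 ltnn.
set X := (T * (T * (12 * T + 30) + 30))%N.
apply: (@wp_time _ _ _ _ _ _ ((((((Tm + N * (X + 12 * T + 30) + 1).+4.+4) + 12 * T + 7).+3)
  + X + 1).+4)); first by lia.
rewrite /= expect_bind; apply: wp_while; first by rewrite /= s10 s11; lia.
apply: wp_seq; run_instr; apply: wp_seq; set s1 := set_idx _ _ _.
have fr1 : frame (regs_arrays [:: 4; 5; 6; 7; 8; 13])
    (regs_arrays [:: 5; 6; 7; 14; 15]) s s1 by apply: frame_set_idx.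
(* Resetting the end pointer is enough to start a new run: [stored [::]] claims nothing, so stale
   array cells are harmless. *)
apply: (@wp_iterate_loop T T [::]) => //; first by case.
move=> s2 l fr2 st s27 lT.
have {}fr2 : frame (regs_arrays [:: 4; 5; 6; 7; 8; 13])
    (regs_arrays [:: 5; 6; 7; 14; 15]) s s2.
  by apply: frame_trans fr1 fr2; apply: subpred_regs_arrays.
apply: wp_seq; run_instr; rewrite !fr2.1 // s3 s15 addn0; apply: wp_seq.
set s2' := set_idx _ _ _.
have fr2' : frame (regs_arrays [:: 4; 5; 6; 7; 8; 13])
    (regs_arrays [:: 5; 6; 7; 14; 15]) s s2' by apply: frame_set_idx.
apply: (@wp_time _ _ _ _ _ _ (((Tm + N * (X + 12 * T + 30) + 1).+4.+4) + 12 * size l + 7)).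
  by rewrite lT; lia.
have s2'12 : imem s2' 12 = 1%N by rewrite fr2'.1.
apply: (@wp_entry l i _ _ s2' _ s2'12 erefl s27 st) => s4 fr4 v5.
have {}fr4 : frame (regs_arrays [:: 4; 5; 6; 7; 8; 13])
    (regs_arrays [:: 5; 6; 7; 14; 15]) s s4.
  by apply: frame_trans fr2' fr4; apply: subpred_regs.
apply: wp_seq; run_instr; apply: wp_seq; run_instr; apply: wp_seq; apply: wp_if.
rewrite v5; set y := combination A l 0 i.
rewrite [eval_test _ _]/= fr4.2 // v3 (mul_conjC y) /=.
(* Common tail of the two branches of the truncation test. The rejecting branch is a dummy write, so
   both take equally long. *)
have end_iter s5 : frame (regs_arrays [:: 4; 5; 6; 7; 8; 11; 13])
      (regs_arrays [:: 5; 6; 7; 8; 14; 15]) s s5 ->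
    imem s5 11 = (N0 - N.+1)%N -> vmem s5 8 = acc + truncate B y ->
    wp (Tm + N * (X + 12 * T + 30) + 1).+1 [:: Instr (IAdd 11 11 12), sum_loop & K] s5
      (expect (sum_distr A b T i B N (acc + truncate B y)) h).
  move=> fr5 s511 v58; run_instr; rewrite s511 fr5.1 // s12; set s6 := set_idx _ _ _.
  have fr6 : frame (regs_arrays [:: 4; 5; 6; 7; 8; 11; 13])
      (regs_arrays [:: 5; 6; 7; 8; 14; 15]) s s6 by apply: frame_set_idx.
  apply: IH; try first [exact: ltnW | exact: v58 | by rewrite fr6.1 | by rewrite fr6.2].
    by rewrite /=; lia.
  by move=> s' S fr; apply: post; apply: frame_trans fr6 fr.
have {}fr4' : frame (regs_arrays [:: 4; 5; 6; 7; 8; 11; 13])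
    (regs_arrays [:: 5; 6; 7; 8; 14; 15]) s s4.
  by apply: frame_trans (frame_refl _ _ s) fr4; apply: subpred_regs_arrays.
move: end_iter; rewrite /truncate; case: ltP => _ end_iter; run_instr; apply: end_iter.
- by do ?[apply: frame_set_idx => // | apply: frame_set_val => //].
- by rewrite /= fr4.1.
- by rewrite /= fr4.2 // v8 v5.
- by do ?[apply: frame_set_idx => // | apply: frame_set_val => //].
- by rewrite /= fr4.1.
- by rewrite /= fr4.2 // v8 addr0.
Qed.

End ProgramCorrectness.

(** * Computing the loop bounds *)

Section Setup.
Variables (R : realType) (m n : nat).
Local Notation C := R[i].
Local Open Scope complex_scope.
Import Normc.
Local Notation memory := (memory R).

Variables (A : 'M[C]_(m, n)) (b : 'cV[C]_m) (f : memory -> R).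
Local Notation wp := (wp A b f).
Local Notation beta := (frobenius_norm b / frobenius_norm A).

Lemma Re_nat (j : nat) : complex.Re (j%:R : C) = j%:R.
Proof. by rewrite -(rmorph_nat (real_complex R)). Qed.

Lemma real_complex_neq0 (x : R) : x != 0 -> x%:C != 0 :> C.
Proof. by rewrite fmorph_eq0. Qed.

(** Solves for [T] the condition that the bias is at most [eps / 8]; the summand 1 makes [T]
    positive. *)
Definition iteration_bound (k : nat) (kappa eps : R) : R :=
  1 + 8 * (k%:R * beta * (k%:R * kappa ^+ 2) ^+ 2) / eps.

Lemma wp_setup_iterations k kappa (eps : R) T P Tm K s v :
  A != 0 -> eps != 0 ->
  (forall j : nat, (j < T)%N = (j%:R < iteration_bound k kappa eps)) ->
  imem s 2 = k -> vmem s 0 = kappa%:C -> vmem s 1 = eps%:C ->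
  (forall s', imem s' 3 = imem s 3 -> imem s' 9 = (base + T)%N -> imem s' 12 = 1%N ->
     imem s' 15 = 0%N -> vmem s' 1 = eps%:C -> vmem s' 2 = vmem s 2 ->
     vmem s' 4 = beta%:C -> vmem s' 9 = 1 -> vmem s' 10 = T%:R ->
     wp Tm (P :: K) s' v) ->
  wp (Tm + 4 * T + 60) (setup_iterations P :: K) s v.
Proof.
move=> A0 eps0 TE s2 v0 v1 post.
have F0 : frobenius_norm A != 0 by rewrite frobenius_eq0.
apply: (@wp_time _ _ _ _ _ _ ((Tm + 4 * (T - 0) + 1).+4.+4.+4.+4.+4.+4.+4.+4.+4.+3)); first by lia.
do 19![apply: wp_seq; run_instr]; apply: wp_seq.
rewrite s2 v0 v1; set s1 := Defs.set_val _ 10 _.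
have v6 : vmem s1 6 = (iteration_bound k kappa eps)%:C.
  rewrite /= /iteration_bound; field.
  by rewrite !real_complex_neq0.
apply: (@wp_counting_loop _ _ _ _ _ _ (fun j => j%:R) T) => //.
- by move=> l _; rewrite /= -natr1.
- move=> l s' lT fr E; rewrite /= E fr.2 // v6 Re_nat /= TE //.
move=> s' fr E10 E9; apply: post => //; try first [by rewrite fr.1 | by rewrite fr.2].
- by rewrite E9 /= subn0 muln1.
- by rewrite fr.2 //= rmorphM fmorphV.
Qed.

(** The first term brings the truncation loss [4 T beta ^ 2 / B] down to [eps / 8]; the second
    ensures [eps <= B], hence [0 < B] even for [b = 0]. *)
Definition truncation_level (T : nat) (eps : R) : R :=
  32 * T%:R * beta ^+ 2 / eps + eps.

(** As 384 is 3 times 128, a batch of this size has Chernoff exponent at least 3. *)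
Definition batch_bound (T : nat) (eps : R) : R :=
  384 * (truncation_level T eps / eps) ^+ 2.

Lemma wp_setup_batch T (eps : R) N P Tm K s v :
  A != 0 -> eps != 0 ->
  (forall j : nat, (j < N)%N = (j%:R < batch_bound T eps)) ->
  imem s 12 = 1%N -> imem s 15 = 0%N -> vmem s 1 = eps%:C -> vmem s 4 = beta%:C ->
  vmem s 9 = 1 -> vmem s 10 = T%:R ->
  (forall s', imem s' 3 = imem s 3 -> imem s' 9 = imem s 9 -> imem s' 12 = 1%N ->
     imem s' 14 = N -> imem s' 15 = 0%N -> vmem s' 2 = vmem s 2 ->
     vmem s' 3 = (truncation_level T eps ^+ 2)%:C -> vmem s' 10 = T%:R ->
     wp Tm (P :: K) s' v) ->
  wp (Tm + 4 * N + 60) (setup_batch P :: K) s v.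
Proof.
move=> A0 eps0 NE s12 s15 v1 v4 v9 v10 post.
have F0 : frobenius_norm A != 0 by rewrite frobenius_eq0.
apply: (@wp_time _ _ _ _ _ _ ((Tm + 4 * (N - 0) + 1).+4.+4.+4.+4.+4.+4.+4.+3)); first by lia.
do 15![apply: wp_seq; run_instr]; apply: wp_seq.
rewrite v1 v4 v10 s15; set s1 := Defs.set_val _ 11 _.
have v6 : vmem s1 6 = (batch_bound T eps)%:C.
  rewrite /= /batch_bound /truncation_level; field.
  by rewrite !real_complex_neq0.
apply: (@wp_counting_loop _ _ _ _ _ _ (fun j => j%:R) N) => //.
- by move=> l _; rewrite /= v9 -natr1.
- move=> l s' lT fr E; rewrite /= E fr.2 // v6 Re_nat /= NE //.
move=> s' fr E10 E9; apply: post; rewrite ?E9 ?[imem s' _]fr.1 ?[vmem s' _]fr.2 //.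
- by rewrite /= subn0 s12 muln1.
- rewrite /= /truncation_level; field.
  by rewrite !real_complex_neq0.
Qed.

Lemma wp_setup_total N L delta P Tm K s v :
  (forall j : nat, (j < L)%N = (delta < 2^-1 ^+ j)) ->
  imem s 12 = 1%N -> imem s 14 = N -> vmem s 2 = delta%:C ->
  (forall s', imem s' 3 = imem s 3 -> imem s' 9 = imem s 9 -> imem s' 10 = (L * N)%N ->
     imem s' 12 = imem s 12 -> imem s' 15 = imem s 15 -> vmem s' 3 = vmem s 3 ->
     vmem s' 10 = vmem s 10 -> wp Tm (P :: K) s' v) ->
  wp (Tm + 4 * L + 20) (setup_total P :: K) s v.
Proof.
move=> LE s12 s14 v2 post.
apply: (@wp_time _ _ _ _ _ _ ((Tm + 4 * (L - 0) + 1).+4.+4.+1)); first by lia.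
do 4![apply: wp_seq; run_instr]; apply: wp_seq.
rewrite s12; set s1 := Defs.set_val _ 12 _.
apply: (@wp_counting_loop _ _ _ _ _ _ (fun j => (2^-1 ^+ j)%:C) L) => //.
- by move=> l _; rewrite /= exprSr rmorphM fmorphV rmorph_nat.
- by move=> l s' lT fr E; rewrite /= E fr.2 //= v2 LE.
move=> s' fr E11 E10; apply: post; rewrite ?E10 ?[imem s' _]fr.1 ?[vmem s' _]fr.2 //.
by rewrite /= subn0 s14.
Qed.

Definition solver_time (T N L : nat) : nat :=
  (4 * T + 4 * N + 4 * L + 200 +
   L * N * (T * (T * (12 * T + 30) + 30) + 12 * T + 30))%N.

Lemma wp_solver (k : nat) (i : 'I_n) (kappa eps delta : R) T N L s :
  A != 0 -> eps != 0 ->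
  (forall j : nat, (j < T)%N = (j%:R < iteration_bound k kappa eps)) ->
  (forall j : nat, (j < N)%N = (j%:R < batch_bound T eps)) ->
  (forall j : nat, (j < L)%N = (delta < 2^-1 ^+ j)) ->
  imem s 2 = k -> imem s 3 = i ->
  vmem s 0 = kappa%:C -> vmem s 1 = eps%:C -> vmem s 2 = delta%:C ->
  forall g : C -> R, (forall S s', vmem s' 0 = conjc (S / (L * N)%:R) -> g S <= f s') ->
  wp (solver_time T N L) [:: solver] s
    (expect (sum_distr A b T i (truncation_level T eps) (L * N) 0) g).
Proof.
move=> A0 eps0 TE NE LE s2 s3 v0 v1 v2 g gf.
set X := (L * N * (T * (T * (12 * T + 30) + 30) + 12 * T + 30))%N.
apply: (@wp_time _ _ _ _ _ _ ((10 + X + 1).+4.+1 + 4 * L + 20 + 4 * N + 60 + 4 * T + 60)).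
  by rewrite /solver_time -/X; lia.
apply: (@wp_setup_iterations k kappa eps) => //.
move=> s4 s43 s49 s412 s415 v41 v42 v44 v49 v410.
apply: (@wp_setup_batch T eps) => //.
move=> s5 s53 s59 s512 s514 s515 v52 v53 v510.
apply: (@wp_setup_total N L delta) => //; first by rewrite v52 v42.
move=> s6 s63 s69 s610 s612 s615 v63 v610.
apply: wp_seq; run_instr; apply: wp_seq; run_instr; apply: wp_seq.
rewrite s615 s515; set s7 := set_idx _ _ _.
apply: (@wp_time _ _ _ _ _ _ (10 + X + 1)); first by lia.
apply: (@wp_sum_loop _ _ _ _ _ _ T i (truncation_level T eps) (L * N)) => //=.
- by rewrite s63 s53 s43.
- by rewrite s69 s59.
- by rewrite subnn.
- by rewrite s612.
- by rewrite s615.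
- by rewrite v63.
- by rewrite v610.
move=> s8 S fr v88; apply: (@wp_time _ _ _ _ _ _ 5) => //.
apply: wp_seq; run_instr; apply: wp_seq; run_instr; run_instr.
apply: wp_nil; apply: gf => /=.
by rewrite v88 fr.1 //= s610.
Qed.

End Setup.

(** * Rounded thresholds and the failure probability *)

Section LoopBounds.
Variable R : realType.

Lemma threshold_exists (p : pred nat) (N : nat) :
  (forall j, p j.+1 -> p j) -> ~~ p N -> exists T, forall j, (j < T)%N = p j.
Proof.
move=> pS pN; have ex : exists j, ~~ p j by exists N.
have pW j l : (j <= l)%N -> p l -> p j.
  by move=> /subnK <-; elim: (l - j)%N => //= d IH /pS.
exists (ex_minn ex) => j; case: ex_minnP => T pT minT; apply/idP/idP => [jT|pj].
  by apply: contraTT jT => /minT; rewrite -leqNgt.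
by rewrite ltnNge; apply: contra pT => /pW; apply.
Qed.

Lemma ceil_exists (x : R) : exists T, forall j : nat, (j < T)%N = (j%:R < x).
Proof.
apply: (@threshold_exists (fun j => j%:R < x) (Num.truncn `|x|).+1).
  by move=> j; apply: lt_trans; rewrite ltr_nat.
rewrite -leNgt (le_trans (ler_norm x)) // ltW //.
by have /andP[] := truncn_itv (normr_ge0 x).
Qed.

Lemma ceil_lt (x : R) T : 0 <= x -> (forall j : nat, (j < T)%N = (j%:R < x)) ->
  T%:R <= x + 1.
Proof.
by case: T => [|T] x0 TE; [rewrite addr_ge0 | rewrite -natr1 lerD2r ltW // -TE].
Qed.

Lemma le_ceil (x : R) T : (forall j : nat, (j < T)%N = (j%:R < x)) -> x <= T%:R.
Proof. by move=> TE; rewrite leNgt -TE ltnn. Qed.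

Lemma halvings_exist (delta : R) : 0 < delta ->
  exists L, forall j : nat, (j < L)%N = (delta < 2^-1 ^+ j).
Proof.
move=> d0; have [N NE] := ceil_exists delta^-1.
apply: (@threshold_exists (fun j => delta < 2^-1 ^+ j) N).
  move=> j /lt_le_trans; apply; rewrite exprS ler_piMl ?exprn_ge0 ?invr_ge0 //.
  by rewrite invf_le1 // ler1n.
rewrite -leNgt exprVn -[leRHS]invrK lef_pV2 ?posrE ?exprn_gt0 ?invr_gt0 //.
apply: le_trans (le_ceil NE) _.
by rewrite -natrX ler_nat ltnW // ltn_expl.
Qed.

(** [L - 1] halvings do not reach [delta], so [2 ^ (L - 1) <= 1 / delta]; [expR (1 / 2) <= 2] then
    gives [(L - 1) / 2 <= ln (1 / delta)]. *)
Lemma halvings_le (delta : R) L : 0 < delta < 1 ->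
  (forall j : nat, (j < L)%N = (delta < 2^-1 ^+ j)) ->
  L%:R <= 2 * (1 + ln delta^-1).
Proof.
move=> /andP[d0 d1] LE.
have L0 : (0 < L)%N by rewrite LE expr0.
have : delta < 2^-1 ^+ L.-1 by rewrite -LE; lia.
have -> : L%:R = L.-1%:R + 1 :> R by rewrite natr1 prednK.
move: L.-1 => l; rewrite exprVn => dl.
have l2 : 2 ^+ l <= delta^-1 by rewrite -[leLHS]invrK lef_pV2 ?posrE ?invr_gt0 ?exprn_gt0 // ltW.
have h2 : expR (1 / 2) <= 2 :> R by apply: le_trans (expR_le_quadratic (lexx _)) _; lra.
have el : expR (l%:R * (1 / 2)) <= delta^-1.
  by rewrite expRM_natl (le_trans _ l2) // lerXn2r ?nnegrE ?expR_ge0.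
have := el; rewrite -ler_ln ?posrE ?expR_gt0 ?invr_gt0 // expRK; lra.
Qed.

(** With [x = expR (- L)] the failure is at most [4 x ^ 3 = x (2 x) ^ 2]. Two factors absorb the 4
    of the union bound, as [x <= 1 / 2], and the third is at most [2 ^ (- L)]. *)
Lemma failure_le (delta q : R) N L : 0 < delta < 1 ->
  (forall j : nat, (j < L)%N = (delta < 2^-1 ^+ j)) -> 3 <= N%:R * q ->
  4 * expR (- ((L * N)%:R * q)) <= delta.
Proof.
move=> /andP[d0 d1] LE Nq.
have L0 : (0 < L)%N by rewrite LE expr0.
have dL : 2^-1 ^+ L <= delta by rewrite leNgt -LE ltnn.
have h : expR (-1) <= 2^-1 :> R.
  by rewrite expRN lef_pV2 ?posrE ?expR_gt0 //; have := expR_ge1Dx (1 : R); lra.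
have hL : expR (- L%:R) <= 2^-1 ^+ L :> R.
  by rewrite -mulrN1 expRM_natl ler_pXn2r ?nnegrE ?expR_ge0 ?invr_ge0.
set x := expR (- L%:R) in hL.
have x0 : 0 <= x by apply: expR_ge0.
have x2 : x <= 1 / 2.
  apply: le_trans hL _; case: L L0 {LE dL x x0} => // l _; rewrite exprS div1r.
  by rewrite ler_piMr ?invr_ge0 // exprn_ile1 ?invr_ge0 // invf_le1 // ler1n.
apply: (le_trans (y := 4 * x ^+ 3)).
  rewrite ler_wpM2l // /x -expRM_natl ler_expR natrM -mulrA mulrN lerN2 [3 * _]mulrC.
  by rewrite ler_wpM2l.
apply: le_trans dL; apply: le_trans hL.
rewrite (_ : 4 * x ^+ 3 = x * (2 * x) ^+ 2); last by ring.
by rewrite ler_piMr // exprn_ile1 ?mulr_ge0 //; lra.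
Qed.

End LoopBounds.

(** * Polynomial bounds on the cost *)

Section Cost.
Variable R : realType.
Local Notation C := R[i].

(** Each term is at most its coefficient times the dominant product: [114 = 12 + 30 + 30 + 12 + 30]
    for one run and [326 = 4 + 4 + 4 + 200 + 114] overall. *)
Lemma solver_time_le T N L : (0 < T)%N -> (0 < N)%N -> (0 < L)%N ->
  (solver_time T N L <= 326 * (N * L * T ^ 3))%N.
Proof.
move=> T0 N0 L0; rewrite /solver_time !expnS expn0 muln1.
set t3 := (T * (T * T))%N; set nl := (N * L)%N.
have nl0 : (0 < nl)%N by rewrite muln_gt0 N0.
have tT : (T <= t3)%N by rewrite leq_pmulr // muln_gt0 T0.
have tT2 : (T * T <= t3)%N by rewrite /t3 leq_pmull // muln_gt0 T0.
have t30 : (0 < t3)%N by apply: leq_trans tT.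
have poly : (T * (T * (12 * T + 30) + 30) + 12 * T + 30 <= 114 * t3)%N.
  have -> : (T * (T * (12 * T + 30) + 30) = 12 * t3 + 30 * (T * T) + 30 * T)%N.
    by rewrite /t3; lia.
  by lia.
have mainle := leq_mul (leqnn nl) poly.
have -> : (L * N = nl)%N by rewrite mulnC.
have Tle : (T <= nl * t3)%N by apply: leq_trans tT _; rewrite leq_pmull.
have Nle : (N <= nl * t3)%N.
  by rewrite (leq_trans (_ : _ <= nl)%N) // leq_pmulr.
have Lle : (L <= nl * t3)%N.
  by rewrite (leq_trans (_ : _ <= nl)%N) ?leq_pmulr // leq_pmull.
have one : (0 < nl * t3)%N by rewrite muln_gt0 nl0.
rewrite mulnCA in mainle; lia.
Qed.

(** The degree 8 is that of [k ^ 3 * kappa ^ 4 / eps], and [10 = 1 + 8 + 1], the last 1 coming from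
    rounding up. *)
Lemma iterations_poly (k be ka ei z w : R) :
  0 <= k <= z -> 0 <= be <= w -> 0 <= ka <= z -> 0 <= ei <= z -> 1 <= z -> 1 <= w ->
  1 + 8 * (k * be * (k * ka ^+ 2) ^+ 2) * ei + 1 <= 10 * (z ^+ 8 * w).
Proof.
move=> /andP[k0 kz] /andP[be0 bew] /andP[ka0 kaz] /andP[ei0 eiz] z1 w1.
have z0 : 0 <= z by apply: le_trans z1.
have ka2 : ka ^+ 2 <= z ^+ 2 by rewrite lerXn2r.
have ka20 := sqr_ge0 ka.
have kk : k * ka ^+ 2 <= z * z ^+ 2 by apply: ler_pM.
have kk0 : 0 <= k * ka ^+ 2 by apply: mulr_ge0.
have kk2 : (k * ka ^+ 2) ^+ 2 <= (z * z ^+ 2) ^+ 2.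
  by rewrite lerXn2r // nnegrE (le_trans kk0).
have kk20 := sqr_ge0 (k * ka ^+ 2).
have kb : k * be <= z * w by apply: ler_pM.
have kb0 : 0 <= k * be by apply: mulr_ge0.
have kbk0 := mulr_ge0 kb0 kk20.
have main := ler_pM kbk0 ei0 (ler_pM kb0 kk20 kb kk2) eiz.
have E : z * w * (z * z ^+ 2) ^+ 2 * z = z ^+ 8 * w by ring.
have one : 1 <= z ^+ 8 * w by rewrite -[1]mulr1 ler_pM // exprn_ege1.
rewrite E in main; rewrite -mulrA; lra.
Qed.

(** The ratio [B / eps] is at most [321 y] with [y = z ^ 10 * w ^ 3] and [321 = 32 * 10 + 1];
    squaring and rounding up give the rest. *)
Lemma batch_poly (t be ei z w : R) :
  0 <= t <= 10 * (z ^+ 8 * w) -> 0 <= be <= w -> 0 <= ei <= z -> 1 <= z -> 1 <= w ->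
  384 * (32 * (t * be ^+ 2 * ei ^+ 2) + 1) ^+ 2 + 1 <=
  385 * 321 ^+ 2 * (z ^+ 20 * w ^+ 6).
Proof.
move=> /andP[t0 tz] /andP[be0 bew] /andP[ei0 eiz] z1 w1.
have z0 : 0 <= z by apply: le_trans z1.
have w0 : 0 <= w by apply: le_trans w1.
have be2 : be ^+ 2 <= w ^+ 2 by rewrite lerXn2r.
have ei2 : ei ^+ 2 <= z ^+ 2 by rewrite lerXn2r.
have be20 := sqr_ge0 be; have ei20 := sqr_ge0 ei.
have tb0 := mulr_ge0 t0 be20; have tbe0 := mulr_ge0 tb0 ei20.
have main := ler_pM tb0 ei20 (ler_pM t0 be20 tz be2) ei2.
pose y := z ^+ 10 * w ^+ 3.
have E : 10 * (z ^+ 8 * w) * w ^+ 2 * z ^+ 2 = 10 * y by rewrite /y; ring.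
have y1 : 1 <= y by rewrite -[1]mulr1 ler_pM // exprn_ege1.
have u : 32 * (t * be ^+ 2 * ei ^+ 2) + 1 <= 321 * y by rewrite E in main; lra.
have u0 : 0 <= 32 * (t * be ^+ 2 * ei ^+ 2) + 1 by lra.
have u2 : (32 * (t * be ^+ 2 * ei ^+ 2) + 1) ^+ 2 <= (321 * y) ^+ 2.
  by rewrite lerXn2r // nnegrE (le_trans u0).
have -> : 385 * 321 ^+ 2 * (z ^+ 20 * w ^+ 6) = 385 * (321 * y) ^+ 2 by rewrite /y; ring.
have one : 1 <= (321 * y) ^+ 2 by rewrite exprn_ege1 //; lra.
move: (_ ^+ 2) ((321 * y) ^+ 2) u2 one => p q; lra.
Qed.

Definition cost_constant : R := 326 * (385 * 321 ^+ 2 * 2 * 10 ^+ 3).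

(** The product has degree [20 + 3 * 8 = 44] in [z] and [6 + 3 = 9] in [w]. All bases are at least
    1, so both fit under the single exponent 50 that [cost_bound] shares among its factors. *)
Lemma total_poly (t nn ll D z w lg : R) :
  0 <= t <= 10 * (z ^+ 8 * w) -> 0 <= nn <= 385 * 321 ^+ 2 * (z ^+ 20 * w ^+ 6) ->
  0 <= ll <= 2 * D -> 0 <= D -> 1 <= z -> 1 <= w -> 1 <= lg ->
  326 * (nn * ll * t ^+ 3) <= cost_constant * z ^+ 50 * lg ^+ 50 * D * w ^+ 50.
Proof.
move=> /andP[t0 tz] /andP[nn0 nnz] /andP[ll0 lld] D0 z1 w1 lg1.
have z0 : 0 <= z by apply: le_trans z1.
have t3 : t ^+ 3 <= (10 * (z ^+ 8 * w)) ^+ 3.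
  by rewrite lerXn2r // nnegrE (le_trans t0).
have t30 : 0 <= t ^+ 3 by apply: exprn_ge0.
have main := ler_pM (mulr_ge0 nn0 ll0) t30 (ler_pM nn0 ll0 nnz lld) t3.
apply: (le_trans (ler_wpM2l (ler0n R 326) main)).
pose p := z ^+ 44 * 1 * D * w ^+ 9; pose q := z ^+ 50 * lg ^+ 50 * D * w ^+ 50.
have -> : 326 * (385 * 321 ^+ 2 * (z ^+ 20 * w ^+ 6) * (2 * D) *
    (10 * (z ^+ 8 * w)) ^+ 3) = cost_constant * p.
  by rewrite /cost_constant /p; ring.
have -> : cost_constant * z ^+ 50 * lg ^+ 50 * D * w ^+ 50 = cost_constant * q.
  by rewrite /q !mulrA.
have w0 : 0 <= w by apply: le_trans w1.
have zz : z ^+ 44 <= z ^+ 50 by apply: ler_weXn2l.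
have ww : w ^+ 9 <= w ^+ 50 by apply: ler_weXn2l.
have lg50 : 1 <= lg ^+ 50 by apply: exprn_ege1.
have z44 : 0 <= z ^+ 44 by apply: exprn_ge0.
have w9 : 0 <= w ^+ 9 by apply: exprn_ge0.
have z441 : 0 <= z ^+ 44 * 1 by rewrite mulr1.
have pq : p <= q.
  apply: ler_pM => //; first by apply: mulr_ge0.
  by apply: ler_wpM2r => //; apply: ler_pM.
apply: ler_wpM2l => //; rewrite /cost_constant.
rewrite -!natrX -!natrM; exact: ler0n.
Qed.

Variables (m n : nat) (A : 'M[C]_(m, n)) (b : 'cV[C]_m) (k : nat) (eps delta : R).
Hypotheses (A0 : A != 0) (eps0 : 0 < eps) (delta01 : 0 < delta < 1).
Hypotheses (m0 : (0 < m)%N) (n0 : (0 < n)%N).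

Local Notation kappa := (condition_number A).
Local Notation beta := (frobenius_norm b / frobenius_norm A).
Local Notation Z := (1 + k%:R + kappa + frobenius_norm A + eps^-1).
Local Notation W := (1 + frobenius_norm b / spectral_norm A).

Lemma iteration_bound_ge1 : 1 <= iteration_bound A b k kappa eps.
Proof.
rewrite lerDl divr_ge0 ?(ltW eps0) // mulr_ge0 // mulr_ge0 ?sqr_ge0 //.
by rewrite mulr_ge0 // divr_ge0 ?frobenius_ge0.
Qed.

Lemma truncation_level_ge T : eps <= truncation_level A b T eps.
Proof.
by rewrite lerDr divr_ge0 ?(ltW eps0) // mulr_ge0 ?sqr_ge0 // mulr_ge0.
Qed.

Lemma batch_bound_gt0 T : 0 < batch_bound A b T eps.
Proof.
have := truncation_level_ge T => h.
have B0 : 0 < truncation_level A b T eps := lt_le_trans eps0 h.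
by rewrite mulr_gt0 ?ltr0n ?exprn_gt0 ?divr_gt0.
Qed.

(** The program uses the Frobenius norm, which it can query, whereas the cost is stated with the
    smaller spectral norm. *)
Lemma beta_le : beta <= W.
Proof.
have s0 := spectral_gt0 A0.
apply: (le_trans (y := frobenius_norm b / spectral_norm A)); last by rewrite lerDr.
rewrite ler_wpM2l ?frobenius_ge0 // lef_pV2 ?posrE ?frobenius_gt0 //.
exact: spectral_le_frobenius.
Qed.

Lemma W_ge1 : 1 <= W.
Proof. by rewrite lerDl divr_ge0 ?frobenius_ge0 // ltW // spectral_gt0. Qed.

Let beta0 : 0 <= beta. Proof. by rewrite divr_ge0 ?frobenius_ge0. Qed.

Lemma parameter_bounds :
  [/\ (0 : R) <= k%:R <= Z, 0 <= beta <= W, 0 <= kappa <= Z, 0 <= eps^-1 <= Z & 1 <= Z].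
Proof.
have kap0 : 0 <= kappa by apply: condition_number_ge0.
have F0 := frobenius_ge0 A; have ei0 : 0 <= eps^-1 by rewrite invr_ge0 ltW.
have k0 : 0 <= k%:R :> R by apply: ler0n.
rewrite beta0 beta_le k0 kap0 ei0 /=.
move: (k%:R) kappa (frobenius_norm A) (eps^-1) k0 kap0 F0 ei0 => x1 x2 x3 x4 *.
by split=> //; lra.
Qed.

Lemma iterations_le T :
  (forall j : nat, (j < T)%N = (j%:R < iteration_bound A b k kappa eps)) ->
  T%:R <= 10 * (Z ^+ 8 * W).
Proof.
move=> TE; have := ceil_lt (le_trans ler01 iteration_bound_ge1) TE.
move/le_trans; apply; have [hk hb hka he hz] := parameter_bounds.
exact: (iterations_poly hk hb hka he hz W_ge1).
Qed.

Lemma batch_le T N :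
  T%:R <= 10 * (Z ^+ 8 * W) ->
  (forall j : nat, (j < N)%N = (j%:R < batch_bound A b T eps)) ->
  N%:R <= 385 * 321 ^+ 2 * (Z ^+ 20 * W ^+ 6).
Proof.
move=> TZ NE; have := ceil_lt (ltW (batch_bound_gt0 T)) NE.
move/le_trans; apply; have [_ hb _ he hz] := parameter_bounds.
have ht : (0 : R) <= T%:R <= 10 * (Z ^+ 8 * W) by rewrite ler0n.
apply: le_trans (batch_poly ht hb he hz W_ge1).
rewrite le_eqVlt; apply/orP; left; apply/eqP.
rewrite /batch_bound /truncation_level; congr (_ * _ ^+ 2 + _).
by field; rewrite (gt_eqF eps0) frobenius_eq0 A0.
Qed.

Lemma solver_time_le_cost T N L :
  (forall j : nat, (j < T)%N = (j%:R < iteration_bound A b k kappa eps)) ->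
  (forall j : nat, (j < N)%N = (j%:R < batch_bound A b T eps)) ->
  (forall j : nat, (j < L)%N = (delta < 2^-1 ^+ j)) ->
  (solver_time T N L)%:R <= cost_bound cost_constant 50 k A b eps delta.
Proof.
move=> TE NE LE; have /andP[d0 d1] := delta01.
have T_gt0 : (0 < T)%N by rewrite TE (lt_le_trans ltr01 iteration_bound_ge1).
have N_gt0 : (0 < N)%N by rewrite NE batch_bound_gt0.
have L_gt0 : (0 < L)%N by rewrite LE expr0.
have TZ := iterations_le TE; have NZ := batch_le TZ NE; have LD := halvings_le delta01 LE.
have [_ _ _ _ hz] := parameter_bounds.
apply: (le_trans (y := 326 * (N%:R * L%:R * T%:R ^+ 3))).
  by rewrite -natrX -2!natrM -(natrM R 326) ler_nat solver_time_le.
apply: total_poly => //.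
- by rewrite ler0n.
- by rewrite ler0n.
- by rewrite ler0n.
- by rewrite addr_ge0 // ln_ge0 // invf_ge1 // ltW.
- exact: W_ge1.
by rewrite -addrA lerDl addr_ge0 // ln_ge0 // ler1n.
Qed.

End Cost.

Theorem theorem1 (R : realType) :
  exists (P : program) (c : R) (d : nat),
  forall (m n k : nat) (A : 'M[R[i]]_(m, n)) (b : 'cV[R[i]]_m),
    A != 0 -> \rank A = k ->
  forall (i : 'I_n) (eps delta : R), 0 < eps -> 0 < delta < 1 ->
  exists Q T : nat,
    [/\ Q%:R <= cost_bound c d k A b eps delta,
        T%:R <= cost_bound c d k A b eps delta,
        uses_at_most A b P k i eps delta Q T
      & 1 - delta <=
        success_probability A b P k i eps delta T ((pseudo_inverse A *m b) i 0)].
Proof.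
exists solver, (cost_constant R), 50%N => m n k A b A0 rankA i eps delta eps0 delta01.
have n0 : (0 < n)%N by apply: leq_ltn_trans (ltn_ord i).
have m0 : (0 < m)%N.
  by case: m A b A0 rankA => // A b /eqP[]; apply/matrixP => -[].
set x := (pseudo_inverse A *m b) i 0.
have [T TE] := ceil_exists (iteration_bound A b k (condition_number A) eps).
have [N NE] := ceil_exists (batch_bound A b T eps).
have [L LE] : exists L, forall j : nat, (j < L)%N = (delta < 2^-1 ^+ j).
  by apply: halvings_exist; case/andP: delta01.
have T_gt0 : (0 < T)%N.
  by rewrite TE (lt_le_trans ltr01) // iteration_bound_ge1.
have N_gt0 : (0 < N)%N by rewrite NE batch_bound_gt0.
have L_gt0 : (0 < L)%N by rewrite LE expr0; case/andP: delta01.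
have cost := solver_time_le_cost A0 eps0 delta01 m0 n0 TE NE LE.
set B := truncation_level A b T eps.
have epsB : eps <= B by apply: truncation_level_ge.
have B0 : 0 < B := lt_le_trans eps0 epsB.
have T_gt0' : 0 < T%:R :> R by rewrite ltr0n.
have bias : (\rank A)%:R * (frobenius_norm b / frobenius_norm A) *
    ((\rank A)%:R * condition_number A ^+ 2) ^+ 2 / T%:R <= eps / 8.
  have := le_ceil TE; rewrite rankA /iteration_bound.
  set y := k%:R * _ * _ => h.
  rewrite ler_pdivrMr // mulrAC ler_pdivlMr // [eps * _]mulrC -ler_pdivrMr //.
  by rewrite [y * 8]mulrC; lra.
have variance : 4 * T%:R * (frobenius_norm b / frobenius_norm A) ^+ 2 / B <= eps / 8.
  rewrite ler_pdivrMr //; set be := (_ / _) ^+ 2.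
  have EB : eps * B = 32 * T%:R * be + eps * eps.
    by rewrite /B /truncation_level -/be; field; rewrite gt_eqF.
  have := mulr_gt0 eps0 eps0; rewrite [eps / 8 * B]mulrAC EB; lra.
have LN_gt0 : (0 < L * N)%N by rewrite muln_gt0 L_gt0.
pose f (s : memory R) : R := (Normc.normc (vmem s 0 - x) <= eps)%R%:R.
pose g (S : R[i]) : R := (Normc.normc (conjc (S / (L * N)%:R) - x) <= eps)%R%:R.
have w0 : wp A b f (solver_time T N L) [:: solver] (init_mem A k i eps delta)
    (expect (sum_distr A b T i B (L * N) 0) g).
  apply: (@wp_solver _ _ _ _ _ _ k i (condition_number A) eps delta) => //.
    by rewrite gt_eqF.
  by move=> S s' E; rewrite /g /f E.
have [halt val] := w0 0%N.
exists (solver_time T N L), (solver_time T N L); split=> //.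
  move: halt (run_queries A b (solver_time T N L) (init A solver k i eps delta)).
  rewrite /uses_at_most /init; move: (run _ _ _ _) => l.
  by elim: l => //= w l IH /andP[-> hl] /andP[-> ql]; apply: IH.
rewrite /success_probability big_mkcond /=.
(* All executions have halted, so the success probability is the expectation of the indicator [f],
   which [wp] bounds from below. *)
have -> : \sum_(w <- run A b (solver_time T N L) (init A solver k i eps delta))
    (if halted w.2 && (Normc.normc (output w.2 - x) <= eps) then w.1 else 0) =
  expect (run A b (solver_time T N L) (init A solver k i eps delta))
    (fun c => f (Defs.mem c)).
  move: halt; rewrite /init; move: (run _ _ _ _) => l; elim: l => [|w l IH].
    by rewrite big_nil expect_nil.
  case/andP=> hw /IH; rewrite big_cons expect_cons hw /= => ->; congr (_ + _).
  by rewrite /f /output; case: ifP; rewrite ?mulr1 ?mulr0.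
apply: le_trans val.
apply: le_trans (average_concentration i A0 T_gt0 eps0 epsB bias variance LN_gt0).
rewrite lerD2l lerN2; apply: failure_le => //.
have := le_ceil NE; rewrite /batch_bound -/B => h.
(* The middle term equals 3, the exponent per batch that [failure_le] asks for. *)
apply: (le_trans (y := 384 * (B / eps) ^+ 2 * (eps ^+ 2 / (128 * B ^+ 2)))); last first.
  by rewrite ler_wpM2r // divr_ge0 ?sqr_ge0 // mulr_ge0 ?sqr_ge0.
rewrite le_eqVlt; apply/orP; left; apply/eqP; field.
by rewrite !gt_eqF.
Qed.
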